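(* Let $f\in L^{p'}(\Omega)$ be a nonnegative function and let $z\in L^p(\Omega)$ satisfy $z\le Gf$ a.e. on $\Omega$. Then the minimization problem $$\inf_{\widetilde\psi\in W_0^{1,p}(\Omega)}J_f(\widetilde\psi),\qquad J_f(\widetilde\psi)=\frac1p\int_\Omega\left\{|T_f(\widetilde\psi)-z|^p+|\nabla\widetilde\psi|^p\right\}dx,$$ has a unique optimal pair, namely $(0,Gf)$.
   Context: $\Omega\subset\mathbb{R}^N$, $N\ge 2$, is a bounded domain whose boundary is piecewise $\mathcal C^1$; $1<p<\infty$ and $p'$ is the conjugate exponent of $p$. For $\psi\in W_0^{1,p}(\Omega)$, $K(\psi)=\{v\in W_0^{1,p}(\Omega): v\ge\psi \text{ a.e. in }\Omega\}$, and for $f\in L^{p'}(\Omega)$, $T_f(\psi)$ denotes the unique solution $u$ of the obstacle problem: $u\in K(\psi)$ and $\int_\Omega |\nabla u|^{p-2}\nabla u\cdot\nabla(v-u)\,dx\ge\int_\Omega f(v-u)\,dx$ for all $v\in K(\psi)$. An optimal pair is a pair $(\psi^*,T_f(\psi^* ))$ where $\psi^*\in W_0^{1,p}(\Omega)$ attains the infimum of $J_f$ over $W_0^{1,p}(\Omega)$. $Gf$ denotes the unique function in $W_0^{1,p}(\Omega)$ satisfying $-\Delta_p(Gf)=f$ in $\Omega$, $Gf=0$ on $\partial\Omega$ (weakly), where $\Delta_p u=\operatorname{div}(|\nabla u|^{p-2}\nabla u)$. *)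

(* Defs.v *)
From HB Require Import structures.
From mathcomp Require Import all_boot all_order all_algebra.
From mathcomp Require Import all_classical all_reals all_analysis.
Import Order.TTheory GRing.Theory Num.Theory.
Import numFieldNormedType.Exports.
Set Implicit Arguments.
Unset Strict Implicit.
Unset Printing Implicit Defensive.
Local Open Scope classical_set_scope.
Local Open Scope ring_scope.

Definition rV_display : measure_display.
Proof. exact: default_measure_display. Qed.

Section rV_measurable.
Context {R : realType} (n : nat).

Definition rV_coord (i : 'I_n) (x : 'rV[R]_n) : measurableTypeR R := x 0 i.

Let rV_set0 : g_sigma_preimage rV_coord set0.
Proof. exact: sigma_algebra0. Qed.

Let rV_setC A : g_sigma_preimage rV_coord A -> g_sigma_preimage rV_coord (~` A).
Proof. exact: sigma_algebraC. Qed.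

Let rV_bigcup (F : (set 'rV[R]_n)^nat) :
  (forall i, g_sigma_preimage rV_coord (F i)) ->
  g_sigma_preimage rV_coord (\bigcup_i F i).
Proof. exact: sigma_algebra_bigcup. Qed.

(* The product sigma-algebra of R^n, which is the Borel one. *)
HB.instance Definition _ := @isMeasurable.Build rV_display 'rV[R]_n
  (g_sigma_preimage rV_coord) rV_set0 rV_setC rV_bigcup.

Lemma measurable_rV_coord (i : 'I_n) : measurable_fun [set: 'rV[R]_n] (rV_coord i).
Proof.
move=> _ Y mY; rewrite setTI; apply: sub_sigma_algebra => /=.
rewrite -bigcup_seq/=; exists i => /=; first by rewrite mem_index_enum.
by exists Y => //; rewrite setTI.
Qed.

Lemma measurable_fun_rV d (T : measurableType d) (f : T -> 'rV[R]_n) :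
  (forall i, measurable_fun [set: T] (rV_coord i \o f)) ->
  measurable_fun [set: T] f.
Proof.
move=> mf; have mf' : g_sigma_preimage (fun i => rV_coord i \o f) `<=` measurable.
  apply: smallest_sub; first exact: sigma_algebra_measurable.
  rewrite -bigcup_seq => A [i _ [B mB <-]]; exact: mf.
move: mf'; rewrite g_sigma_preimage_comp => mf' _ A mA.
by apply: mf'; exists A.
Qed.

End rV_measurable.

Section lebesgue_rV.
Context {R : realType}.

Definition rV_cons n (xv : measurableTypeR R * 'rV[R]_n) : 'rV[R]_n.+1 :=
  \row_i (if unlift ord0 i is Some j then xv.2 0 j else xv.1).

Definition rV_uncons n (w : 'rV[R]_n.+1) : measurableTypeR R * 'rV[R]_n :=
  (w 0 ord0, \row_j w 0 (lift ord0 j)).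

Lemma rV_consK n : cancel (@rV_cons n) (@rV_uncons n).
Proof.
move=> [x v]; congr pair; first by rewrite mxE unlift_none.
by apply/rowP => j; rewrite !mxE liftK.
Qed.

Lemma rV_unconsK n : cancel (@rV_uncons n) (@rV_cons n).
Proof. by move=> w; apply/rowP => i; rewrite mxE; case: unliftP => [j|] -> /=; rewrite ?mxE. Qed.

Lemma measurable_rV_cons n : measurable_fun setT (@rV_cons n).
Proof.
apply: measurable_fun_rV => i; case: (unliftP ord0 i) => [j ->|->].
  rewrite (_ : _ \o _ = @rV_coord R n j \o snd); last first.
    by apply/funext => -[x v]; rewrite /rV_coord /= mxE liftK.
  by apply: measurableT_comp => //; exact: measurable_rV_coord.
rewrite (_ : _ \o _ = fst)//.
by apply/funext => -[x v]; rewrite /rV_coord /= mxE unlift_none.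
Qed.

Lemma measurable_rV_uncons n : measurable_fun setT (@rV_uncons n).
Proof.
apply/measurable_fun_pair; first exact: (@measurable_rV_coord R n.+1 ord0).
apply: measurable_fun_rV => j.
rewrite (_ : _ \o _ = @rV_coord R n.+1 (lift ord0 j)).
  exact: measurable_rV_coord.
by apply/funext => w; rewrite /rV_coord /= mxE.
Qed.

Section step.
Variables (n : nat) (mu : {sigma_finite_measure set 'rV[R]_n -> \bar R}).

Definition lebesgue_rV_step : set 'rV[R]_n.+1 -> \bar R :=
  pushforward (lebesgue_measure \x mu)%E (@rV_cons n).

Let measurable_preimage_cons A :
  measurable A -> measurable (@rV_cons n @^-1` A).
Proof. by move=> mA; rewrite -[X in measurable X]setTI; exact: measurable_rV_cons. Qed.

Let step0 : lebesgue_rV_step set0 = 0%E.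
Proof. by rewrite /lebesgue_rV_step /pushforward preimage_set0 measure0. Qed.

Let step_ge0 A : (0 <= lebesgue_rV_step A)%E.
Proof. by rewrite /lebesgue_rV_step /pushforward measure_ge0. Qed.

Let step_sigma_additive : semi_sigma_additive lebesgue_rV_step.
Proof.
move=> F mF tF mUF; rewrite /lebesgue_rV_step /pushforward preimage_bigcup.
apply: measure_semi_sigma_additive.
- by move=> k; exact: measurable_preimage_cons.
- apply/trivIsetP => /= i j _ _ ij; rewrite -preimage_setI.
  by move/trivIsetP : tF => /(_ _ _ _ _ ij) ->//; rewrite preimage_set0.
- by rewrite -preimage_bigcup; exact: measurable_preimage_cons.
Qed.

HB.instance Definition _ := isMeasure.Build _ _ _
  lebesgue_rV_step step0 step_ge0 step_sigma_additive.

Let step_sigma_finite : sigma_finite setT lebesgue_rV_step.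
Proof.
have [F FT mF] := sigma_finiteT (@lebesgue_measure R).
have [G GT mG] := sigma_finiteT mu.
pose FG k := if unpickle k is Some (i, j) then F i `*` G j else set0.
have FGT : \bigcup_k FG k = setT.
  rewrite -subTset => -[x v] _.
  have [i _ Fix] : (\bigcup_i F i) x by rewrite -FT.
  have [j _ Gjv] : (\bigcup_j G j) v by rewrite -GT.
  by exists (pickle (i, j)) => //; rewrite /FG pickleK.
exists (fun k => @rV_uncons n @^-1` FG k).
  by rewrite -preimage_bigcup FGT preimage_setT.
move=> k; have [mFG FG_fin] :
    measurable (FG k) /\ ((lebesgue_measure \x mu) (FG k) < +oo)%E.
  rewrite /FG; case: unpickle => [[i j]|]; last by rewrite measure0.
  have [mFi Fi_fin] := mF i; have [mGj Gj_fin] := mG j.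
  split; first exact: measurableX.
  by rewrite product_measure1E// lte_mul_pinfty// ge0_fin_numE.
split.
  by rewrite -[X in measurable X]setTI; exact: measurable_rV_uncons.
rewrite /lebesgue_rV_step /pushforward -comp_preimage.
rewrite (_ : _ \o _ = id) ?preimage_id//.
by apply/funext => xv; exact: rV_consK.
Qed.

HB.instance Definition _ :=
  Measure_isSigmaFinite.Build _ _ _ lebesgue_rV_step step_sigma_finite.

End step.

Fixpoint lebesgue_rV n : {sigma_finite_measure set 'rV[R]_n -> \bar R} :=
  if n is m.+1 then lebesgue_rV_step (lebesgue_rV m) else dirac (0 : 'rV[R]_0).

Lemma lebesgue_rV_box n (a b : 'rV[R]_n) : (forall i, a 0 i <= b 0 i) ->
  lebesgue_rV n [set x | forall i, a 0 i <= x 0 i <= b 0 i] =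
  (\prod_(i < n) (b 0 i - a 0 i))%:E.
Proof.
elim: n => [|n IHn] in a b * => ab.
  rewrite big_ord0 /= diracE mem_set// => -[]//.
pose a' := (rV_uncons a).2; pose b' := (rV_uncons b).2.
have ab' i : a' 0 i <= b' 0 i by rewrite !mxE.
have mI m (c d : 'rV[R]_m) : measurable [set x : 'rV_m | forall i, c 0 i <= x 0 i <= d 0 i].
  rewrite (_ : [set _ | _] =
      \bigcap_(i in [set: 'I_m]) (rV_coord i @^-1` `[c 0 i, d 0 i])); last first.
    apply/seteqP; split=> x /= xcd i; first by move=> _; rewrite /= in_itv/=.
    by have := xcd i I; rewrite /= in_itv.
  apply: fin_bigcap_measurable => // i _.
  by rewrite -[X in measurable X]setTI; apply: measurable_rV_coord.
rewrite /= /lebesgue_rV_step /pushforward.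
rewrite (_ : _ @^-1` _ = `[a 0 ord0, b 0 ord0] `*`
    [set x : 'rV_n | forall i, a' 0 i <= x 0 i <= b' 0 i]); last first.
  apply/seteqP; split=> -[x v] /=.
    move=> h; split; first by have := h ord0; rewrite mxE unlift_none /= in_itv.
    by move=> i; have := h (lift ord0 i); rewrite !mxE liftK.
  rewrite in_itv/= => -[hx hv] i; rewrite mxE.
  by case: unliftP => [j|] -> //=; have := hv j; rewrite !mxE.
rewrite product_measure1E//; last exact: mI.
rewrite IHn// big_ord_recl.
rewrite [X in (X * _)%E](lebesgue_measure_itv `[a 0 ord0, b 0 ord0])/= lte_fin.
have -> : \prod_(i < n) (b' 0 i - a' 0 i) =
    \prod_(i < n) (b 0 (lift ord0 i) - a 0 (lift ord0 i)).
  by apply: eq_bigr => i _; rewrite !mxE.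
case: ltP => [_|ba]; first by rewrite -EFinB -EFinM.
by rewrite (@le_anti _ _ (b 0 ord0) (a 0 ord0)) ?ba ?ab// subrr !mul0r mul0e.
Qed.

End lebesgue_rV.

Section euclidean.
Context {R : realType} {N : nat}.
Implicit Types a b : 'rV[R]_N.

Definition dotrV a b : R := \sum_(i < N) a 0 i * b 0 i.

(* The Euclidean norm; the library norm `|a| on matrices is the max norm. *)
Definition enorm a : R := Num.sqrt (dotrV a a).

End euclidean.

Section piecewise_C1.
Context {R : realType}.

Definition C1_on n (U : set 'rV[R]_n) (h : 'rV[R]_n -> R) : Prop :=
  forall (j : 'I_n) (x : 'rV[R]_n), U x ->
    derivable h x (delta_mx 0 j) /\
    {for x, continuous (fun y => 'D_(delta_mx 0 j) h y)}.

(* A C^1 parametrized patch: the image of the closed unit cube of R^(N-1) under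
   a map that is C^1 near the cube and, on the open cube, an injective immersion
   (degeneracies such as the tip of a cone may occur on the edge). *)
Definition C1_patch N (S : set 'rV[R]_N) : Prop :=
  exists (U : set 'rV[R]_N.-1) (gamma : 'rV[R]_N.-1 -> 'rV[R]_N),
    let cube := [set x : 'rV[R]_N.-1 | forall j, 0 <= x 0 j <= 1] in
    let ocube := [set x : 'rV[R]_N.-1 | forall j, 0 < x 0 j < 1] in
    [/\ open U, cube `<=` U,
        forall i : 'I_N, C1_on U (fun x => gamma x 0 i),
        {in ocube &, injective gamma} /\
        (forall x, ocube x -> row_free (jacobian gamma x)) &
        S = gamma @` cube].

Definition boundary N (Omega : set 'rV[R]_N) : set 'rV[R]_N :=
  closure Omega `\` interior Omega.

Definition piecewise_C1_boundary N (Omega : set 'rV[R]_N) : Prop :=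
  exists (m : nat) (S : 'I_m -> set 'rV[R]_N),
    (forall k, C1_patch (S k)) /\ boundary Omega = \bigcup_k S k.

Definition bounded_domain N (Omega : set 'rV[R]_N) : Prop :=
  [/\ open Omega, connected Omega, Omega !=set0 & bounded_set Omega].

End piecewise_C1.

(* Elements of L^p and W^{1,p} are represented by functions on the whole space,
   of which only the restriction to Omega matters, up to null sets. *)
Section sobolev.
Context {R : realType} {N : nat}.
Variable Omega : set 'rV[R]_N.
Local Notation leb := (lebesgue_rV N : {measure set 'rV[R]_N -> \bar R}).
Implicit Types (u v phi psi : 'rV[R]_N -> R) (G : 'rV[R]_N -> 'rV[R]_N).

Definition Lp_on (p : \bar R) u : Prop :=
  (u \_ Omega : 'rV[R]_N -> R) \in Lfun leb p.

Definition le_ae u v : Prop := {ae leb, forall x, Omega x -> u x <= v x}.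

Definition eq_ae u v : Prop := {ae leb, forall x, Omega x -> u x = v x}.

Definition cgrad phi (x : 'rV[R]_N) : 'rV[R]_N :=
  \row_(i < N) 'D_(delta_mx 0 i) phi x.

(* The support of phi is closed in the whole space, so the test functions are
   those of C_c^1(Omega) extended by 0. *)
Definition test_fun phi : Prop :=
  [/\ C1_on setT phi, compact (closure [set x | phi x != 0]) &
      closure [set x | phi x != 0] `<=` Omega].

Definition is_weak_grad (p : R) u G : Prop :=
  (forall i, Lp_on p%:E (fun x => G x 0 i)) /\
  forall phi, test_fun phi -> forall i : 'I_N,
    \int[leb]_(x in Omega) (u x * 'D_(delta_mx 0 i) phi x) =
    - \int[leb]_(x in Omega) (G x 0 i * phi x).

Definition W1p (p : R) u : Prop :=
  Lp_on p%:E u /\ exists G, is_weak_grad p u G.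

(* A representative of the weak gradient, unique up to null sets. *)
Definition wgrad (p : R) u : 'rV[R]_N -> 'rV[R]_N :=
  xget (cst 0) [set G | is_weak_grad p u G].

(* W_0^{1,p}(Omega) as the closure of C_c^1(Omega) in W^{1,p}(Omega) (the
   convention of Brezis and of Gilbarg-Trudinger). *)
Definition W01p (p : R) u : Prop :=
  W1p p u /\
  forall e : R, 0 < e -> exists2 phi, test_fun phi &
    (\int[leb]_(x in Omega)
       (`|u x - phi x| `^ p + enorm (wgrad p u x - cgrad phi x) `^ p)%:E
     < e%:E)%E.

(* |a|^(p-2) a; the value at a = 0 is 0 for every p. *)
Definition pflux (p : R) (a : 'rV[R]_N) : 'rV[R]_N :=
  (enorm a `^ (p - 2)) *: a.

Definition p_form (p : R) u v : R :=
  \int[leb]_(x in Omega) dotrV (pflux p (wgrad p u x)) (wgrad p v x).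

(* - Delta_p u = f in Omega, u = 0 on the boundary, in the weak sense. *)
Definition dirichlet_solution (p : R) f u : Prop :=
  W01p p u /\
  forall v, W01p p v -> p_form p u v = \int[leb]_(x in Omega) (f x * v x).

Definition obstacle_set (p : R) psi v : Prop := W01p p v /\ le_ae psi v.

Definition obstacle_solution (p : R) f psi u : Prop :=
  obstacle_set p psi u /\
  forall v, obstacle_set p psi v ->
    \int[leb]_(x in Omega) (f x * (v x - u x)) <=
    p_form p u (fun x => v x - u x).

(* T is a solution operator psi |-> T_f(psi) of the obstacle problem; by
   uniqueness it is determined up to null sets on W_0^{1,p}(Omega). *)
Definition obstacle_operator (p : R) f (T : ('rV[R]_N -> R) -> 'rV[R]_N -> R) :
    Prop :=
  forall psi, W01p p psi -> obstacle_solution p f psi (T psi).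

Definition cost (p : R) (T : ('rV[R]_N -> R) -> 'rV[R]_N -> R) z psi : \bar R :=
  (p^-1%:E * \int[leb]_(x in Omega)
     (`|T psi x - z x| `^ p + enorm (wgrad p psi x) `^ p)%:E)%E.

Definition optimal_pair (p : R) (T : ('rV[R]_N -> R) -> 'rV[R]_N -> R) z psi u :
    Prop :=
  [/\ W01p p psi, eq_ae u (T psi) &
      cost p T z psi = ereal_inf [set cost p T z psi' | psi' in [set v | W01p p v]]].

End sobolev.

(* Main.v *)
Require Import Defs.
From mathcomp Require Import all_boot all_order all_algebra.
From mathcomp Require Import all_classical all_reals all_analysis.
From mathcomp Require Import measurable_realfun.
From mathcomp Require Import ring lra.
Import Order.TTheory GRing.Theory Num.Theory.
Import numFieldNormedType.Exports.
Set Implicit Arguments.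
Unset Strict Implicit.
Unset Printing Implicit Defensive.
Local Open Scope classical_set_scope.
Local Open Scope ring_scope.

(** The null obstacle is optimal for both terms of the cost at once.

Whatever the obstacle [psi], adding a nonnegative function to [T psi] keeps it
above [psi], so that [T psi] is a supersolution of - Delta_p u = f, and the
comparison principle gives [Gf <= T psi] ([dirichlet_le_obstacle]). On the other
hand [0 <= f] gives [0 <= Gf], again by comparison; hence [Gf] is admissible in the
obstacle problem for the null obstacle, and testing the two problems against each
other yields [T 0 = Gf] ([obstacle0_dirichlet]). Since [z <= Gf <= T psi], the
distance from [T psi] to [z] is least for [psi = 0], where the gradient term is
null as well. An optimal [psi] therefore has a null gradient, so that [psi = 0] and
[T psi = Gf] almost everywhere ([cost_minimum]).

Comparison and uniqueness both rest on the strict monotonicity of the flux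
[|a|^(p-2) a] ([monotone_test_eq0]). The comparison principle is usually tested
with the positive part of the difference of the two functions. Here this is
replaced by [rint], a C^1 function that is positive exactly on the positive
half-line and has a Lipschitz derivative with values between 0 and 1; the chain
rule for it in W_0^{1,p} ([strong_grad_rint]) is then a limit of the classical
one.

The closure of the test functions is described by [strong_grad], in terms of
strong limits of classical gradients. It fits the definition by weak gradients
because these are unique ([weak_grad_unique]), by the fundamental lemma
[ae_eq0_of_test]. That a function of W_0^{1,p} with null gradient is null
([strong_grad_eq0]) comes from integrating by parts against C^1 functions that are
not required to vanish on the boundary, with a partial derivative close to the
indicator of a given box. Behind both facts lie [integral_partial_eq0], which is
integration by parts for test functions, and [ae_eq0_of_obox], by which a function
is determined by its integrals over boxes. *)

(** * A smooth substitute for the positive part *)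

Section real_functions.
Context {R : realType}.
Implicit Types (F f : R -> R) (s t : R).

Definition pospart (t : R) : R := Num.max t 0.

Lemma pospart_ge0 t : 0 <= pospart t.
Proof. by rewrite /pospart le_max lexx orbT. Qed.

Lemma pospart_id t : 0 <= t -> pospart t = t.
Proof. by move=> t0; rewrite /pospart; apply/max_idPl. Qed.

Lemma pospart_eq0 t : t <= 0 -> pospart t = 0.
Proof. by move=> t0; rewrite /pospart; apply/max_idPr. Qed.

Lemma pospart_gt0 t : (0 < pospart t) = (0 < t).
Proof. by rewrite /pospart lt_max ltxx orbF. Qed.

Lemma continuous_pospart : continuous pospart.
Proof.
have -> : pospart = (fun t => (t + `|t|) / 2).
  by apply/funext => t; rewrite /pospart maxr_absE addr0 subr0.
move=> t; apply: cvgM; last exact: cvg_cst.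
apply: cvgD; first exact: cvg_id.
exact: norm_continuous.
Qed.

(** In Caratheodory's form of the derivative the corner at 0 is harmless: the
slope function of [F] is merely composed with the positive part. *)
Lemma is_derive_pospart F f : (forall t, is_derive t 1 F (f t)) -> f 0 = 0 ->
  forall t, is_derive t 1 (F \o pospart) (f (pospart t)).
Proof.
move=> dF f0 t; have [t0|t0|->] := ltgtP t 0.
- rewrite pospart_eq0 ?(ltW t0)// f0.
  apply: (@near_eq_is_derive _ _ _ (cst (F 0))).
  near=> s => /=; rewrite pospart_eq0// ltW//; near: s.
  exact: lt_nbhsl.
- rewrite pospart_id ?(ltW t0)//.
  apply: (@near_eq_is_derive _ _ _ F).
  near=> s => /=; rewrite pospart_id// ltW//; near: s.
  exact: lt_nbhsr.
- rewrite pospart_id// f0.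
  have /is_derive1_caratheodory[g [Fg gc g0]] := dF 0.
  apply/is_derive1_caratheodory; exists (g \o pospart); split => /=.
  + move=> z; rewrite (pospart_id (lexx 0)) Fg !subr0.
    have [z0|z0] := leP 0 z; first by rewrite pospart_id.
    by rewrite pospart_eq0 ?(ltW z0)// g0 f0 !mul0r.
  + apply: continuous_comp; first exact: continuous_pospart.
    by rewrite pospart_id.
  + by rewrite pospart_id// g0 f0.
Unshelve. all: end_near. Qed.

Lemma contraction_of_derive F f : (forall t, is_derive t 1 F (f t)) ->
  (forall t, `|f t| <= 1) -> forall s t, `|F s - F t| <= `|s - t|.
Proof.
move=> dF f1.
have H s t : s <= t -> `|F s - F t| <= `|s - t|.
  move=> st; have [|c _ E] := @MVT_segment _ F f s t st.
    apply: derivable_within_continuous => x _.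
    by have [] := dF x.
  by rewrite distrC E normrM distrC ler_piMl.
move=> s t; have [/H//|/ltW/H] := leP s t.
by rewrite distrC [X in _ <= X]distrC.
Qed.

(** [rint] is a smooth stand-in for the positive part, null exactly where
that is null, and [rsat] is its derivative: squaring removes the corner at
0, and the denominator keeps the slope at most 1. *)
Definition rsat (t : R) : R := pospart t ^+ 2 / (1 + pospart t ^+ 2).

Definition drsat (t : R) : R := 2 * pospart t / (1 + pospart t ^+ 2) ^+ 2.

Definition rint (t : R) : R := pospart t - atan (pospart t).

Let den_gt0 t : 0 < 1 + t ^+ 2.
Proof. by rewrite ltr_pwDl// sqr_ge0. Qed.

Let den_neq0 t : 1 + t ^+ 2 != 0.
Proof. by rewrite gt_eqF. Qed.

Lemma rsat_ge0 t : 0 <= rsat t.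
Proof. by rewrite /rsat divr_ge0 ?sqr_ge0// ltW. Qed.

Lemma rsat_le1 t : rsat t <= 1.
Proof. by rewrite /rsat ler_pdivrMr// mul1r lerDr. Qed.

Lemma rsat_gt0 t : (0 < rsat t) = (0 < t).
Proof.
rewrite /rsat pmulr_lgt0 ?invr_gt0// -pospart_gt0.
by rewrite exprn_even_gt0//= lt0r pospart_ge0 andbT.
Qed.

Lemma rsat_eq0 t : t <= 0 -> rsat t = 0.
Proof. by move=> t0; rewrite /rsat pospart_eq0// expr0n mul0r. Qed.

Lemma is_derive_rsat t : is_derive t 1 rsat (drsat t).
Proof.
pose F (t : R) := t ^+ 2 / (1 + t ^+ 2).
apply: (@is_derive_pospart F (fun t => 2 * t / (1 + t ^+ 2) ^+ 2)); last first.
  by rewrite mulr0 mul0r.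
move=> {}t.
have dsq : is_derive t 1 (fun t : R => t ^+ 2) (2 * t).
  have := is_deriveX 2 (is_derive_id t (1:R)).
  by rewrite /= expr1 /GRing.scale /= mulr1.
have dD : is_derive t 1 (fun t : R => 1 + t ^+ 2) (2 * t).
  have := is_deriveD (is_derive_cst (1:R) t (1:R)) dsq.
  by rewrite add0r.
have dV := @is_deriveV _ (fun t : R => 1 + t ^+ 2) _ _ _ (den_neq0 t) dD.
have := is_deriveM dsq dV.
move=> h; apply: is_derive_eq.
rewrite /GRing.scale /=; field.
exact: den_neq0.
Qed.

Lemma continuous_rsat : continuous rsat.
Proof.
by move=> t; apply: differentiable_continuous; apply/derivable1_diffP; have [] := is_derive_rsat t.
Qed.

Lemma continuous_drsat : continuous drsat.
Proof.
move=> t; rewrite /drsat.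
have cp := @continuous_pospart t.
have cD : {for t, continuous (fun t => 1 + pospart t ^+ 2)}.
  by apply: cvgD; [exact: cvg_cst|exact: (@continuous_comp _ _ _ pospart (fun s : R => s ^+ 2) t cp (@exprn_continuous _ 2 _))].
apply: cvgM; first by apply: cvgM => //; exact: cvg_cst.
apply: cvgV; first by rewrite expf_neq0.
exact: (@continuous_comp _ _ _ _ (fun s : R => s ^+ 2) t cD (@exprn_continuous _ 2 _)).
Qed.

Lemma is_derive_rint t : is_derive t 1 rint (rsat t).
Proof.
pose F (t : R) := t - atan t.
apply: (@is_derive_pospart F (fun t => t ^+ 2 / (1 + t ^+ 2))); last first.
  by rewrite expr0n mul0r.
move=> {}t; rewrite /F; apply: is_derive_eq.
by field; exact: den_neq0.
Qed.

Lemma continuous_rint : continuous rint.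
Proof.
by move=> t; apply: differentiable_continuous; apply/derivable1_diffP; have [] := is_derive_rint t.
Qed.

Lemma contraction_rint s t : `|rint s - rint t| <= `|s - t|.
Proof.
apply: (contraction_of_derive is_derive_rint) => {s}t.
by rewrite ger0_norm ?rsat_ge0// rsat_le1.
Qed.

Lemma contraction_rsat s t : `|rsat s - rsat t| <= `|s - t|.
Proof.
apply: (contraction_of_derive is_derive_rsat) => {s}t.
have m0 := pospart_ge0 t.
rewrite ger0_norm /drsat; last by rewrite divr_ge0 ?mulr_ge0 ?exprn_ge0// ltW.
rewrite ler_pdivrMr ?exprn_gt0// mul1r.
move: (pospart t) m0 => m m0; nra.
Qed.

Lemma rint0 t : t <= 0 -> rint t = 0.
Proof. by move=> t0; rewrite /rint pospart_eq0// atan0 subr0. Qed.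

Lemma norm_rint_le t : `|rint t| <= `|t|.
Proof. by have := contraction_rint t 0; rewrite (rint0 (lexx 0)) !subr0. Qed.

Lemma rint_gt0 t : 0 < t -> 0 < rint t.
Proof.
move=> t0; rewrite -(rint0 (lexx 0)) -subr_gt0.
have [|c] := @MVT _ rint rsat 0 t t0 (fun x _ => is_derive_rint x).
  by apply: continuous_subspaceT; exact: continuous_rint.
by rewrite in_itv/= => /andP[c0 ct] ->; rewrite mulr_gt0 ?subr0// rsat_gt0.
Qed.

Lemma rint_ge0 t : 0 <= rint t.
Proof. by have [/rint0->//|/rint_gt0/ltW] := leP t 0. Qed.

(** Rescaling turns [rsat] into an approximate indicator of the open half-line,
out of which the bumps and ramps below are built. *)
Lemma cvg_rsat t : rsat (k%:R * t) @[k --> \oo] --> ((0 < t)%R%:R : R).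
Proof.
have [t0|t0] /= := ltP 0 t; last first.
  apply: cvg_near_cst; apply: nearW => k.
  by rewrite rsat_eq0// mulr_ge0_le0.
apply/cvgrPdist_lt => e e0.
have [n nE] : exists n : nat, (e * t) ^-1 < n%:R.
  by exists (Num.truncn (e * t)^-1).+1; rewrite truncnS_gt.
near=> k.
have k1 : 1 <= k%:R :> R by rewrite ler1n; near: k; exact: nbhs_infty_gt.
have kt : e^-1 < k%:R * t.
  rewrite -ltr_pdivrMr// -invfM (lt_le_trans nE)// ler_nat.
  near: k; exact: nbhs_infty_ge.
rewrite /rsat pospart_id; last by rewrite mulr_ge0// ltW.
have kt0 : 0 < k%:R * t by rewrite mulr_gt0// (lt_le_trans _ k1).
have e1 : 1 < e * (k%:R * t) by rewrite -ltr_pdivrMl// mulr1.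
move: (k%:R * t) (e1) kt0 => s {}e1 s0.
have -> : 1 - s ^+ 2 / (1 + s ^+ 2) = (1 + s ^+ 2)^-1.
  by field; exact: den_neq0.
rewrite ger0_norm ?invr_ge0 ?(ltW (den_gt0 _))//.
rewrite -[ltLHS]mul1r ltr_pdivrMr//.
by have [s1|s1] := leP 1 s; nra.
Unshelve. all: end_near. Qed.

End real_functions.

(** * Functions of class C^1 *)

Section directional.
Context {R : realType} {V : normedModType R}.
Implicit Types (h : V -> R) (x v : V) (t d : R).

Let line_quotient h x v t :
  (fun k : R => k^-1 *: (((fun s : R => h (x + s *: v)) \o shift t) (k *: 1) -
     h (x + t *: v))) =
  (fun k : R => k^-1 *: ((h \o shift (x + t *: v)) (k *: v) - h (x + t *: v))).
Proof.
apply/funext => k; congr (_ *: (h _ - _)).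
by rewrite /= scalerDl [k *: 1]mulr1 addrCA.
Qed.

Lemma is_derive_line h x v t d : is_derive (x + t *: v) v h d ->
  is_derive t 1 (fun s : R => h (x + s *: v)) d.
Proof.
by move=> [dh <-]; split; rewrite /derivable /derive line_quotient.
Qed.

Lemma is_derive_of_line h x v d : is_derive (0:R) (1:R) (fun s : R => h (x + s *: v)) d ->
  is_derive x v h d.
Proof.
have := line_quotient h x v 0; rewrite scale0r addr0 => E.
by move=> [dh <-]; split; move: dh; rewrite /derivable /derive -E scale0r addr0.
Qed.

Lemma is_derive_comp1 (F : R -> R) h x v f d : is_derive (h x) 1 F f ->
  is_derive x v h d -> is_derive x v (F \o h) (f * d).
Proof.
move=> dF dh; apply: is_derive_of_line.
apply: (@is_derive1_comp _ F (fun s => h (x + s *: v))).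
  by rewrite scale0r addr0.
by apply: is_derive_line; rewrite scale0r addr0.
Qed.

Lemma mean_value_bound (F f : R -> R) (M s : R) :
  (forall t : R, is_derive t (1:R) F (f t)) -> (forall t, `|t| <= `|s| -> `|f t| <= M) ->
  `|F s - F 0| <= M * `|s|.
Proof.
move=> dF fM.
have Fc (a b : R) : {within `[a, b], continuous F}.
  by apply: derivable_within_continuous => y _; have [] := dF y.
have [s0|s0] := leP 0 s.
  have [c] := @MVT_segment _ F f 0 s s0 (fun y _ => dF y) (Fc _ _).
  rewrite in_itv/= => /andP[c0 cs] ->; rewrite subr0 normrM ler_wpM2r//.
  by apply: fM; rewrite !ger0_norm.
have [c] := @MVT_segment _ F f s 0 (ltW s0) (fun y _ => dF y) (Fc _ _).
rewrite in_itv/= => /andP[sc c0]; rewrite distrC => ->.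
rewrite sub0r normrM normrN ler_wpM2r//.
by apply: fM; rewrite !ler0_norm ?lerN2// ltW.
Qed.

End directional.

Section C1_functions.
Context {R : realType} {n : nat}.
Implicit Types (h : 'rV[R]_n -> R) (x y : 'rV[R]_n).

Lemma norm_coord_le x i : `|x 0 i| <= `|x|.
Proof.
rewrite /Num.norm/= mx_normrE.
by apply: (@le_bigmax_cond _ _ _ 0 (0, i) xpredT (fun ij : 'I_1 * 'I_n => `|x ij.1 ij.2|)).
Qed.

Lemma norm_rV_lt x (e : R) : 0 < e -> (`|x| < e) = [forall i, `|x 0 i| < e].
Proof.
move=> e0; apply/idP/forallP => [xe i|xe].
  exact: le_lt_trans (norm_coord_le _ _) xe.
rewrite /Num.norm/= mx_normrE; apply: bigmax_lt => // -[i j] _ /=.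
by rewrite ord1.
Qed.

Lemma norm_rV_le x (e : R) : 0 <= e -> (forall i, `|x 0 i| <= e) -> `|x| <= e.
Proof.
move=> e0 xe.
rewrite /Num.norm/= mx_normrE; apply: bigmax_le => // -[i j] _ /=.
by rewrite ord1.
Qed.

Lemma continuous_add (f g : 'rV[R]_n -> R) : continuous f -> continuous g ->
  continuous (fun x : 'rV[R]_n => f x + g x : R).
Proof. by move=> fc gc x; exact: (@cvgD _ _ _ _ _ f g _ _ (fc x) (gc x)). Qed.

Lemma continuous_mul (f g : 'rV[R]_n -> R) : continuous f -> continuous g ->
  continuous (fun x : 'rV[R]_n => f x * g x : R).
Proof. by move=> fc gc x; exact: (@cvgM _ _ _ _ f g _ _ (fc x) (gc x)). Qed.

Lemma continuous_const (c : R) : continuous (fun _ : 'rV[R]_n => c).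
Proof. exact: cst_continuous. Qed.

Lemma C1P h : C1_on setT h <-> forall j : 'I_n, exists g : 'rV[R]_n -> R,
  continuous g /\ forall x, is_derive x (delta_mx 0 j) h (g x).
Proof.
split=> [C j|H j x _].
  exists ('D_(delta_mx 0 j) h); split => x; have [//|dh ch] := C j x => //.
have [g [gc dg]] := H j.
have [dh E] := dg x; split => //.
have -> : (fun y => 'D_(delta_mx 0 j) h y) = g by apply/funext => y; have [] := dg y.
exact: gc.
Qed.

Lemma C1_is_derive h : C1_on setT h -> forall j x,
  is_derive x (delta_mx 0 j) h ('D_(delta_mx 0 j) h x).
Proof. by move=> C j x; have [//|dh ch] := C j x. Qed.

Lemma C1_continuous_derive h : C1_on setT h -> forall j,
  continuous ('D_(delta_mx 0 j) h).
Proof. by move=> C j x; have [//|dh ch] := C j x. Qed.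

(** Partial derivatives control [h] only along the axes, so [x] is joined to [y]
by moving one coordinate at a time. *)
Lemma partial_mean_value h x y (M r : R) : C1_on setT h ->
  (forall j z, `|z - x| <= r -> `|'D_(delta_mx 0 j) h z| <= M) ->
  `|y - x| <= r -> `|h y - h x| <= n%:R * M * `|y - x|.
Proof.
move=> C hM yxr.
pose z k : 'rV[R]_n := \row_i (if (i < k)%N then y 0 i else x 0 i).
have zn : z n = y by apply/rowP => i; rewrite mxE ltn_ord.
have z0 : z 0%N = x by apply/rowP => i; rewrite mxE.
suff H k : (k <= n)%N -> `|h (z k) - h x| <= k%:R * M * `|y - x|.
  by rewrite -{1}zn; exact: H.
elim: k => [_|k IH kn]; first by rewrite z0 subrr normr0 !mul0r.
rewrite -[_ - _](subrKA (h (z k))) -natr1 mulrDl mul1r mulrDl.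
rewrite addrC (le_trans (ler_normD _ _))// lerD ?IH// ?(ltnW kn)//.
pose i := Ordinal kn.
have zk : z k.+1 = z k + (y 0 i - x 0 i) *: delta_mx 0 i.
  apply/rowP => j; rewrite !mxE eqxx /= ltnS leq_eqVlt.
  have [->|ji] := eqVneq j i; first by rewrite eqxx ltnn /= mulr1 addrC subrK.
  have /negPf -> : (j : nat) != k by apply: contra ji => /eqP jk; apply/eqP/val_inj.
  by rewrite /= mulr0 addr0.
have Mi := norm_coord_le (y - x) i; rewrite !mxE in Mi.
apply: (@le_trans _ _ (M * `|y 0 i - x 0 i|)).
  have := @mean_value_bound _ (fun s => h (z k + s *: delta_mx 0 i))
    (fun s => 'D_(delta_mx 0 i) h (z k + s *: delta_mx 0 i)) M (y 0 i - x 0 i).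
  rewrite scale0r addr0 -zk; apply.
    by move=> t; apply: is_derive_line; exact: C1_is_derive.
  move=> t ti; apply: hM; apply: norm_rV_le; first exact: le_trans yxr.
  move=> j; rewrite !mxE eqxx/=.
  have [->|ji] := eqVneq j i.
    by rewrite ltnn /= mulr1 addrAC subrr add0r (le_trans ti)// (le_trans Mi).
  rewrite /= mulr0 addr0; case: ifP => _; last by rewrite subrr normr0 (le_trans _ yxr).
  by have := norm_coord_le (y - x) j; rewrite !mxE => /le_trans; apply.
rewrite ler_wpM2l//.
by apply: le_trans (hM i x _); rewrite // subrr normr0 (le_trans _ yxr).
Qed.

(** Partial derivatives that are continuous are locally bounded, which makes [h]
locally Lipschitz by [partial_mean_value]. *)
Lemma C1_continuous h : C1_on setT h -> continuous h.
Proof.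
move=> C x.
have [M [M0 HM]] : exists M : R, 0 <= M /\
    \forall z \near x, forall j : 'I_n, `|'D_(delta_mx 0 j) h z| <= M.
  exists (\sum_j (`|'D_(delta_mx 0 j) h x| + 1)); split.
    by apply: sumr_ge0 => j _; rewrite addr_ge0.
  set S := \sum_j _.
  have := @filter_forall _ _ (fun (j : 'I_n) => [set z | `|'D_(delta_mx 0 j) h z| <= S]) (nbhs x) _.
  apply => j; rewrite /S.
  have : \forall z \near x, `|'D_(delta_mx 0 j) h z - 'D_(delta_mx 0 j) h x| < 1.
    by have /cvgrPdistC_lt := @C1_continuous_derive h C j x; apply.
  apply: filterS => z zx; rewrite (bigD1 j)//= ler_wpDr//.
    by apply: sumr_ge0 => k _; rewrite addr_ge0.
  rewrite -[in leLHS](subrK ('D_(delta_mx 0 j) h x) ('D_(delta_mx 0 j) h z)).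
  by rewrite addrC (le_trans (ler_normD _ _))// lerD2l ltW.
have /nbhs_normP[r /= r0 rM] := HM.
have nx (d : R) : 0 < d -> \forall y \near x, `|x - y| < d.
  by move=> d0; apply/nbhs_normP; exists d.
apply/(@cvgrPdistC_lt _ _ _ (nbhs x) _ h (h x)) => e e0.
have k0 : 0 < n%:R * M + 1 by rewrite ltr_wpDl// mulr_ge0.
near=> y.
have yr : `|y - x| <= r / 2.
  rewrite distrC ltW//; near: y.
  by apply: nx; rewrite divr_gt0.
apply: (@le_lt_trans _ _ (n%:R * M * `|y - x|)).
  apply: (@partial_mean_value _ _ _ _ (r / 2)) => // j z zx.
  apply: rM => /=; rewrite distrC (le_lt_trans zx)//.
  by rewrite ltr_pdivrMr// ltr_pMr// ltr1n.
apply: (@le_lt_trans _ _ ((n%:R * M + 1) * `|y - x|)).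
  by rewrite ler_wpM2r// lerDl.
rewrite -ltr_pdivlMl// distrC; near: y.
by apply: nx; rewrite mulr_gt0// invr_gt0.
Unshelve. all: end_near. Qed.

Lemma is_derive_invariant h x v : (forall s : R, h (x + s *: v) = h x) ->
  is_derive x v h 0.
Proof.
move=> H; apply: is_derive_of_line.
rewrite (_ : (fun s => _) = cst (h x)); last by apply: funext => s; rewrite H.
exact: is_derive_cst.
Qed.

Lemma C1_cst (c : R) : C1_on setT (cst c : 'rV[R]_n -> R).
Proof.
apply/C1P => j; exists (cst 0); split; first exact: continuous_const.
by move=> x; exact: is_derive_cst.
Qed.

Lemma C1D h1 h2 : C1_on setT h1 -> C1_on setT h2 -> C1_on setT (h1 \+ h2).
Proof.
move=> C1 C2; apply/C1P => j.
exists (fun x => 'D_(delta_mx 0 j) h1 x + 'D_(delta_mx 0 j) h2 x); split.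
  by apply: continuous_add; exact: C1_continuous_derive.
by move=> x; apply: is_deriveD; exact: C1_is_derive.
Qed.

Lemma C1M h1 h2 : C1_on setT h1 -> C1_on setT h2 -> C1_on setT (h1 \* h2).
Proof.
move=> C1 C2; apply/C1P => j.
exists (fun x => h1 x * 'D_(delta_mx 0 j) h2 x + h2 x * 'D_(delta_mx 0 j) h1 x); split.
  by apply: continuous_add; apply: continuous_mul;
    by [exact: C1_continuous_derive|exact: C1_continuous].
by move=> x; apply: is_deriveM; exact: C1_is_derive.
Qed.

Lemma C1_comp (F f : R -> R) h : (forall t : R, is_derive t (1:R) F (f t)) ->
  continuous f -> C1_on setT h -> C1_on setT (F \o h).
Proof.
move=> dF fc C; apply/C1P => j.
exists (fun x => f (h x) * 'D_(delta_mx 0 j) h x); split.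
  apply: continuous_mul; last exact: C1_continuous_derive.
  move=> x; apply: continuous_comp; [exact: C1_continuous|exact: fc].
by move=> x; apply: is_derive_comp1; exact: C1_is_derive.
Qed.

Lemma derive_comp1 (F f : R -> R) h : (forall t : R, is_derive t (1:R) F (f t)) ->
  C1_on setT h -> forall j x,
  'D_(delta_mx 0 j) (F \o h) x = f (h x) * 'D_(delta_mx 0 j) h x.
Proof.
move=> dF C j x.
by have [] := is_derive_comp1 (dF (h x)) (C1_is_derive C j x).
Qed.

Lemma is_derive_coord i j x :
  is_derive x (delta_mx 0 j) (fun y : 'rV[R]_n => y 0 i) (i == j)%:R.
Proof.
apply: is_derive_of_line.
rewrite (_ : (fun s => _) = (fun s => x 0 i + s * (i == j)%:R)); last first.
  by apply/funext => s; rewrite !mxE eqxx.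
have := is_deriveD (is_derive_cst (x 0 i) (0 : R) (1:R))
  (is_deriveM (is_derive_id (0:R) (1:R)) (is_derive_cst ((i == j)%:R : R) (0 : R) (1:R))).
rewrite add0r scaler0 add0r [_ *: 1]mulr1.
exact.
Qed.

Lemma C1_coord i : C1_on setT (fun y : 'rV[R]_n => y 0 i).
Proof.
apply/C1P => j; exists (cst (i == j)%:R); split; first exact: continuous_const.
by move=> x; exact: is_derive_coord.
Qed.

Lemma C1_prod (r : seq 'I_n) (P : pred 'I_n) (F : 'I_n -> 'rV[R]_n -> R) :
  (forall i, C1_on setT (F i)) -> C1_on setT (fun x => \prod_(i <- r | P i) F i x).
Proof.
move=> CF; elim: r => [|i r IH].
  rewrite (_ : (fun x => _) = cst 1); first exact: C1_cst.
  by apply/funext => x; rewrite big_nil.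
rewrite (_ : (fun x => _) = if P i then (F i \* (fun x => \prod_(i <- r | P i) F i x))
   else (fun x => \prod_(i <- r | P i) F i x)).
  by case: (P i); [exact: (C1M (CF i) IH)|exact: IH].
by apply/funext => x; rewrite big_cons; case: (P i).
Qed.

Lemma continuous_bounded_on h (A : set 'rV[R]_n) : continuous h -> bounded_set A ->
  exists M : R, 0 <= M /\ forall x, A x -> `|h x| <= M.
Proof.
move=> hc [r [_ rA]].
pose s := `|r| + 1.
have s0 : 0 <= s by rewrite addr_ge0.
have As x : A x -> `|x| <= s.
  move=> Ax; apply: rA => //; rewrite /s.
  by rewrite (le_lt_trans (ler_norm r))// ltrDl.
pose B := [set x : 'rV[R]_n | `|x| <= s].
have cB : compact B.
  apply: bounded_closed_compact.
    by exists s; split; [exact: num_real|move=> t st x /= xs; exact: le_trans xs (ltW st)].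
  rewrite (_ : B = (fun x : 'rV[R]_n => `|x|) @^-1` [set t | t <= s])//.
  apply: closed_comp; last exact: closed_le.
  by move=> x _; exact: norm_continuous.
have [||c cB' cM] := @EVT_max_rV _ _ (fun x => `|h x|) B _ cB.
- by exists 0; rewrite /B /= normr0.
- apply: continuous_subspaceT => x; apply: continuous_comp; first exact: hc.
  exact: norm_continuous.
exists `|h c|; split => // x /As xs; apply: cM.
by rewrite inE.
Qed.

End C1_functions.

(** * Boxes and Borel sets *)

Section boxes.
Context {R : realType} {n : nat}.
Local Notation leb := (lebesgue_rV n : {measure set 'rV[R]_n -> \bar R}).
Implicit Types (a b x : 'rV[R]_n) (A U : set 'rV[R]_n).

Definition obox a b := [set x : 'rV[R]_n | forall i, a 0 i < x 0 i < b 0 i].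

Definition cbox a b := [set x : 'rV[R]_n | forall i, a 0 i <= x 0 i <= b 0 i].

Lemma sub_obox_cbox a b : obox a b `<=` cbox a b.
Proof. by move=> x abx i; have /andP[ax xb] := abx i; rewrite !ltW. Qed.

Lemma measurable_obox a b : measurable (obox a b).
Proof.
rewrite (_ : obox a b =
    \bigcap_(i in [set: 'I_n]) (rV_coord i @^-1` `]a 0 i, b 0 i[)); last first.
  apply/seteqP; split=> x /= xcd i; first by move=> _; rewrite /= in_itv/=.
  by have := xcd i I; rewrite /= in_itv.
apply: fin_bigcap_measurable => // i _.
by rewrite -[X in measurable X]setTI; apply: measurable_rV_coord.
Qed.

Lemma measurable_cbox a b : measurable (cbox a b).
Proof.
rewrite (_ : cbox a b =
    \bigcap_(i in [set: 'I_n]) (rV_coord i @^-1` `[a 0 i, b 0 i])); last first.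
  apply/seteqP; split=> x /= xcd i; first by move=> _; rewrite /= in_itv/=.
  by have := xcd i I; rewrite /= in_itv.
apply: fin_bigcap_measurable => // i _.
by rewrite -[X in measurable X]setTI; apply: measurable_rV_coord.
Qed.

Lemma oboxI a b c d : obox a b `&` obox c d =
  obox (\row_i Num.max (a 0 i) (c 0 i)) (\row_i Num.min (b 0 i) (d 0 i)).
Proof.
apply/seteqP; split => x /=.
  move=> [h1 h2] i; rewrite !mxE gt_max lt_min.
  by have /andP[-> ->] := h1 i; have /andP[-> ->] := h2 i.
move=> h; split => i; have := h i; rewrite !mxE gt_max lt_min.
  by move=> /andP[/andP[-> _] /andP[-> _]].
by move=> /andP[/andP[_ ->] /andP[_ ->]].
Qed.

Lemma obox_setI : setI_closed [set A | exists a b, A = obox a b].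
Proof. by move=> _ _ [a [b ->]] [c [d ->]]; rewrite oboxI; do 2 eexists. Qed.

Lemma measurable_gen_obox :
  @measurable _ 'rV[R]_n = <<s [set A | exists a b, A = obox a b] >>.
Proof.
set G := [set A | _].
apply/seteqP; split; last first.
  apply: smallest_sub; first exact: sigma_algebra_measurable.
  by move=> _ [a [b ->]]; exact: measurable_obox.
apply: smallest_sub; first exact: smallest_sigma_algebra.
rewrite -bigcup_seq => A [i _ [Y mY <-]].
have : measurable_fun [set: g_sigma_algebraType G]
    (rV_coord i : g_sigma_algebraType G -> measurableTypeR R).
  apply: (measurability _ (RGenOpens.measurableE R)).
  move=> _ [_ [c [d ->] <-]]; rewrite setTI.
  (* The slab between [c] and [d] is exhausted by boxes of half-width [k]. *)
  rewrite (_ : _ @^-1` _ = \bigcup_k (obox (\row_j (if j == i then c else - k%:R))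
     (\row_j (if j == i then d else k%:R)))).
    apply: (@bigcup_measurable _ (g_sigma_algebraType G)) => k _.
    by apply: sub_sigma_algebra; eexists; eexists; reflexivity.
  apply/seteqP; split => x /=.
    rewrite in_itv/= => cxd.
    exists (Num.truncn `|x|).+1 => // j; rewrite !mxE.
    case: eqP => [->//|_].
    rewrite -ltr_norml (le_lt_trans (norm_coord_le x j))//.
    by rewrite truncnS_gt.
  by move=> [k _ /(_ i)]; rewrite !mxE eqxx in_itv.
by move=> /(_ measurableT Y mY); rewrite setTI.
Qed.

(** Rational corners make every open set a countable union of boxes. *)
Lemma open_rational_box U x : open U -> U x -> exists q : 'rV[rat]_n * 'rV[rat]_n,
  obox (map_mx ratr q.1) (map_mx ratr q.2) x /\
  cbox (map_mx ratr q.1) (map_mx ratr q.2) `<=` U.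
Proof.
move=> oU Ux; have /nbhs_normP[r /= r0 rU] : nbhs x U by exact: open_nbhs_nbhs.
have A (i : 'I_n) : exists q : rat, x 0 i - r < ratr q < x 0 i.
  have [|q] := @rat_in_itvoo R (x 0 i - r) (x 0 i); first by rewrite gtrBl.
  by rewrite in_itv; exists q.
have B (i : 'I_n) : exists q : rat, x 0 i < ratr q < x 0 i + r.
  have [|q] := @rat_in_itvoo R (x 0 i) (x 0 i + r); first by rewrite ltrDl.
  by rewrite in_itv; exists q.
have [a aP] := choice A; have [b bP] := choice B.
exists (\row_i a i, \row_i b i); split => /=.
  by move=> i; rewrite !mxE; have /andP[_ ->] := aP i; have /andP[-> _] := bP i.
move=> y aby; apply: rU => /=.
rewrite norm_rV_lt//; apply/forallP => i; have := aby i; rewrite !mxE.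
have := aP i; have := bP i; rewrite distrC ltr_distl.
move=> /andP[_ h1] /andP[h2 _] /andP[h3 h4].
by rewrite (lt_le_trans h2)//= (le_lt_trans h4).
Qed.

Lemma open_measurable_rV U : open U -> measurable U.
Proof.
move=> oU.
pose D := [set q : 'rV[rat]_n * 'rV[rat]_n |
  cbox (map_mx ratr q.1) (map_mx ratr q.2) `<=` U].
rewrite (_ : U = \bigcup_(q in D) (obox (map_mx ratr q.1) (map_mx ratr q.2))).
  rewrite bigcup_mkcond; apply: countable_bigcupT_measurable => [|q]; first exact: countableP.
  by case: ifP => // _; exact: measurable_obox.
apply/seteqP; split => [x Ux|x [q Dq]].
  by have [q [xq qU]] := open_rational_box oU Ux; exists q.
by move=> /sub_obox_cbox/Dq.
Qed.

Lemma continuous_measurable_rV (h : 'rV[R]_n -> R) (D : set 'rV[R]_n) :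
  continuous h -> measurable D -> measurable_fun D h.
Proof.
move=> hc mD; apply: (measurability _ (RGenOpens.measurableE R)).
move=> _ [_ [c [d ->] <-]]; apply: measurableI => //.
apply: open_measurable_rV; apply: open_comp; last exact: interval_open.
by move=> x _; exact: hc.
Qed.

Lemma bounded_sub_cbox A : bounded_set A ->
  exists r : R, 0 <= r /\ A `<=` cbox (const_mx (- r)) (const_mx r).
Proof.
move=> [r [_ rA]]; exists (`|r| + 1); split; first by rewrite addr_ge0.
move=> x Ax i; rewrite !mxE -ler_norml (le_trans (norm_coord_le x i))//.
apply: (rA (`|r| + 1)) => //; rewrite (le_lt_trans (ler_norm r))// ltrDl//.
Qed.

Lemma closed_cbox a b : closed (cbox a b).
Proof.
rewrite (_ : cbox a b = \bigcap_(i in [set: 'I_n])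
   ((fun x : 'rV[R]_n => x 0 i) @^-1` `[a 0 i, b 0 i])); last first.
  apply/seteqP; split=> x /= xcd i; first by move=> _; rewrite /= in_itv/=.
  by have := xcd i I; rewrite /= in_itv.
apply: closed_bigI => i _; apply: closed_comp; last exact: itv_closed.
by move=> x _; exact: coord_continuous.
Qed.

Lemma bounded_cbox a b : bounded_set (cbox a b).
Proof.
pose r : R := \sum_i (`|a 0 i| + `|b 0 i|).
exists r; split; first exact: num_real.
move=> t rt x /= xab; apply: le_trans (ltW rt); apply: norm_rV_le.
  by apply: sumr_ge0 => i _; rewrite addr_ge0.
move=> i; rewrite /r (bigD1 i)//= ler_wpDr//.
  by apply: sumr_ge0 => j _; rewrite addr_ge0.
have /andP[ax xb] := xab i.
rewrite ler_norml; apply/andP; split.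
  rewrite (le_trans _ ax)// lerNl (le_trans (ler_norm _))// normrN.
  by rewrite lerDl.
by rewrite (le_trans xb)// (le_trans (ler_norm _))// lerDr.
Qed.

Lemma cbox_lty a b : (leb (cbox a b) < +oo)%E.
Proof.
have [ab|] := pselect (forall i, a 0 i <= b 0 i).
  by rewrite [X in (X < _)%E]lebesgue_rV_box// ltry.
move=> /existsNP[i /negP]; rewrite -ltNge => ba.
rewrite (_ : cbox a b = set0) ?measure0//.
apply/seteqP; split => // x /(_ i) /andP[/le_trans h /h].
by rewrite leNgt ba.
Qed.

Lemma bounded_lty A : measurable A -> bounded_set A -> (leb A < +oo)%E.
Proof.
move=> mA /bounded_sub_cbox[r [_ Ar]].
apply: (le_lt_trans _ (cbox_lty (const_mx (- r)) (const_mx r))).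
by apply: le_measure; rewrite ?inE//; exact: measurable_cbox.
Qed.

(** Boxes form a pi-system generating the Borel sets, so an integrable function
is determined up to a null set by its integrals over them. *)
Lemma ae_eq0_of_obox (g : 'rV[R]_n -> R) a b :
  leb.-integrable setT (EFin \o g) ->
  (forall x, ~ obox a b x -> g x = 0) ->
  (forall c d, (\int[leb]_(x in obox c d) (g x)%:E = 0)%E) ->
  {ae leb, forall x, g x = 0}.
Proof.
move=> ig gab gbox.
have mg := measurable_int _ ig.
pose P (A : set 'rV[R]_n) := (\int[leb]_(x in A) (g x)%:E = 0)%E.
have PT : P setT.
  rewrite /P -(gbox a b) [RHS]integral_mkcond; apply: eq_integral => x _.
  by rewrite patchE; case: ifPn => // /negP; rewrite inE => /gab ->.
have Pall A : measurable A -> P A.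
  rewrite measurable_gen_obox; apply: dynkin_induction => //.
  - exact: measurable_gen_obox.
  - exact: obox_setI.
  - by move=> _ [c [d ->]]; exact: gbox.
  - move=> S mS PS; have := PT; rewrite /P -(setUv S).
    rewrite integral_setU//=.
    + by rewrite [X in (X + _)%E]PS add0e.
    + exact: measurableC.
    + by rewrite setUv.
    + by apply/disj_set2P; rewrite setICr.
  - move=> F mF tF PF; rewrite /P integral_bigcup//.
      by rewrite eseries0// => k _ _; exact: PF.
    by apply: (integrableS measurableT) => //; exact: bigcup_measurable.
have : ae_eq leb setT (EFin \o g) (cst 0%E).
  apply: (integral_ae_eq measurableT ig) => // E _ mE.
  by rewrite integral_cst// mul0e; exact: Pall.
by apply: filterS => x /(_ I) /= [].
Qed.

End boxes.

(** * Integrals of partial derivatives *)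

Section partial_integrals.
Context {R : realType}.
Local Notation leb n := (lebesgue_rV n : {measure set 'rV[R]_n -> \bar R}).

Lemma continuous_rV (T : topologicalType) n (h : T -> 'rV[R]_n) :
  (forall i, continuous (fun t => h t 0 i)) -> continuous h.
Proof.
move=> hc t; apply/(@cvgrPdist_lt _ _ _ (nbhs t) _ h (h t)) => e e0.
have := @filter_forall _ _ (fun (j : 'I_n) => [set s | `|h t 0 j - h s 0 j| < e]) (nbhs t) _.
move=> /(_ _) H; apply: filterS (H _); last first.
- move=> j; have /(@cvgrPdist_lt _ _ _ (nbhs t)) := hc j t.
  exact.
- by move=> s hs; rewrite norm_rV_lt//; apply/forallP => j; rewrite !mxE; exact: hs.
Qed.

Lemma integrable_of_cbox n (h : 'rV[R]_n -> R) a b : continuous h ->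
  (forall x, ~ cbox a b x -> h x = 0) -> (leb n).-integrable setT (EFin \o h).
Proof.
move=> hc h0.
have -> : EFin \o h = (EFin \o h) \_ (cbox a b).
  apply/funext => x; rewrite patchE; case: ifPn => // /negP.
  by rewrite inE /= => /h0 ->.
apply/(integrable_mkcond _ (measurable_cbox a b)).
apply: measurable_bounded_integrable.
- exact: measurable_cbox.
- exact: cbox_lty.
- by apply: continuous_measurable_rV => //; exact: measurable_cbox.
have [|M [_ hM]] := @continuous_bounded_on R n h (cbox a b) hc.
  exact: bounded_cbox.
exists M; split; first exact: num_real.
by move=> t Mt x /= xab; exact: le_trans (hM _ xab) (ltW Mt).
Qed.

Lemma is_derive_near0 n (g : 'rV[R]_n -> R) x v d : (\near x, g x = 0) ->
  is_derive x v g d -> d = 0.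
Proof.
move=> g0 dg.
have : is_derive x v g 0.
  apply: (@near_eq_is_derive _ _ _ (cst 0)).
  by apply: filterS g0 => y ->.
by have [_ <-] := dg => -[_ <-].
Qed.

(** The fundamental theorem of calculus between two points outside of which [F]
vanishes. *)
Lemma integral_derive_line (F f : R -> R) (M : R) : 0 <= M ->
  (forall t : R, is_derive t (1:R) F (f t)) -> continuous f ->
  (forall t, M < `|t| -> F t = 0) ->
  (\int[lebesgue_measure]_t (f t)%:E = 0)%E.
Proof.
move=> M0 dF fc F0.
have f0 t : M < `|t| -> f t = 0.
  move=> Mt; have : is_derive t (1:R) F 0.
    apply: (@near_eq_is_derive _ _ _ (cst 0)).
    near=> s; rewrite /= F0//; near: s.
    have : open [set s : R | M < `|s|].
      apply: (@open_comp _ _ (fun s : R => `|s|) [set s | M < s]).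
        by move=> s _; exact: norm_continuous.
      exact: open_gt.
    by move=> oS; apply: open_nbhs_nbhs.
  by have [_ <-] := dF t => -[_ <-].
transitivity (\int[lebesgue_measure]_(t in `[(- (M + 1))%R, (M + 1)%R]) (f t)%:E)%E.
  rewrite [RHS]integral_mkcond; apply: eq_integral => t _.
  rewrite patchE; case: ifPn => // /negP; rewrite inE /= in_itv/=.
  rewrite -ler_norml => /negP; rewrite -ltNge => Mt.
  by rewrite f0// (lt_trans _ Mt)// ltrDl.
rewrite (@continuous_FTC2 _ f F).
- rewrite !F0 ?normrN ?subee//; rewrite ger0_norm ?ltrDl// addr_ge0//.
- by rewrite gtrN// ltr_pwDr.
- exact: continuous_subspaceT.
- have Fd t : derivable F t 1 by have [] := dF t.
  have Fc : continuous F.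
    by move=> t; apply: differentiable_continuous; exact/derivable1_diffP.
  split => //.
  + by apply: cvg_at_right_filter; exact: Fc.
  + by apply: cvg_at_left_filter; exact: Fc.
- by move=> t _; rewrite derive1E; have [] := dF t.
Unshelve. all: end_near. Qed.

Lemma rV_cons_lift0 n t (v : 'rV[R]_n) :
  rV_cons (t, v) = rV_cons (0, v) + t *: delta_mx 0 ord0.
Proof.
apply/rowP => i; rewrite !mxE /=; case: unliftP => [j ->|->] /=.
  by rewrite !mulr0 addr0.
by rewrite mulr1 add0r.
Qed.

Lemma rV_cons_lift n t (v : 'rV[R]_n) s j :
  rV_cons (t, v + s *: delta_mx 0 j) =
  rV_cons (t, v) + s *: delta_mx 0 (lift ord0 j).
Proof.
apply/rowP => i; rewrite !mxE /=; case: unliftP => [k ->|->] /=.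
  by rewrite !mxE (inj_eq (@lift_inj _ ord0)).
by rewrite mulr0 addr0.
Qed.

Lemma continuous_rV_cons1 n (v : 'rV[R]_n) : continuous (fun t : R => rV_cons (t, v)).
Proof.
apply: continuous_rV => i.
case: (unliftP ord0 i) => [j ->|->].
  rewrite (_ : (fun t => _) = cst (v 0 j)); first exact: cst_continuous.
  by apply/funext => t; rewrite mxE liftK.
rewrite (_ : (fun t => _) = id); first by move=> t; exact: cvg_id.
by apply/funext => t; rewrite mxE unlift_none.
Qed.

Lemma continuous_rV_cons2 n (t : R) : continuous (fun v : 'rV[R]_n => rV_cons (t, v)).
Proof.
apply: continuous_rV => i.
case: (unliftP ord0 i) => [j ->|->].
  rewrite (_ : (fun v => _) = (fun v : 'rV[R]_n => v 0 j)).
    exact: coord_continuous.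
  by apply/funext => v; rewrite mxE liftK.
rewrite (_ : (fun v => _) = cst t); first exact: cst_continuous.
by apply/funext => v; rewrite mxE unlift_none.
Qed.

(** By Fubini's theorem it suffices to integrate first along the direction of the
derivative, where [integral_derive_line] applies. The induction fixes the first
coordinate unless that is the direction [i]; a bound on the coordinates, rather
than a compact support, passes to the slices. *)
Lemma integral_partial_eq0 n (i : 'I_n) (g dg : 'rV[R]_n -> R) (M : R) :
  0 <= M ->
  (forall x, is_derive x (delta_mx 0 i) g (dg x)) -> continuous dg ->
  (forall (x : 'rV[R]_n) j, M < `|x 0 j| -> g x = 0) ->
  (\int[leb n]_x (dg x)%:E = 0)%E.
Proof.
elim: n => [|n IH] in i g dg *; first by case: i.
move=> M0 gdg dgc g0.
have dg0 (x : 'rV[R]_n.+1) j : M < `|x 0 j| -> dg x = 0.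
  move=> Mx; apply: is_derive_near0 (gdg x).
  near=> y; apply: (g0 _ j); near: y.
  have : open [set y : 'rV[R]_n.+1 | M < `|y 0 j|].
    apply: (@open_comp _ _ (fun y : 'rV[R]_n.+1 => `|y 0 j|) [set s | M < s]).
      move=> s _; apply: continuous_comp; first exact: coord_continuous.
      exact: norm_continuous.
    exact: open_gt.
  by move=> oS; apply: open_nbhs_nbhs.
have dgi : (leb n.+1).-integrable setT (EFin \o dg).
  apply: (@integrable_of_cbox _ _ (const_mx (- M)) (const_mx M)) => // x.
  move=> /existsNP[j]; rewrite !mxE -ler_norml => /negP.
  by rewrite -ltNge; exact: dg0.
have mdg := measurable_int _ dgi.
pose mu := (@lebesgue_measure R \x lebesgue_rV n)%E.
have dgi' : mu.-integrable setT ((EFin \o dg) \o @rV_cons R n).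
  have mc := @measurable_rV_cons R n.
  apply/integrableP; split; first exact: measurableT_comp.
  have /integrableP[_] := dgi.
  rewrite [X in (X < _)%E -> _](_ : _ =
      \int[mu]_(x in @rV_cons R n @^-1` setT) ((abse \o (EFin \o dg)) \o @rV_cons R n) x)%E.
    by rewrite preimage_setT.
  apply: (ge0_integral_pushforward mc) => //.
  by apply: measurableT_comp.
rewrite [LHS](_ : _ = \int[mu]_(x in @rV_cons R n @^-1` setT)
    ((EFin \o dg) \o @rV_cons R n) x)%E; last first.
  by apply: (integral_pushforward (@measurable_rV_cons R n)) => //;
     rewrite preimage_setT.
rewrite preimage_setT.
case: (unliftP ord0 i) => [j ij|ij]; rewrite {i}ij in gdg.
- rewrite -integral12_prod_meas1//; apply: integral0_eq => t _.
  rewrite /fubini_F /=.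
  apply: (IH j (fun v => g (rV_cons (t, v))) (fun v => dg (rV_cons (t, v)))) => //.
  + move=> v; apply: is_derive_of_line.
    rewrite (_ : (fun s => _) =
       (fun s : R => g (rV_cons (t, v) + s *: delta_mx 0 (lift ord0 j)))).
      by apply: is_derive_line; rewrite scale0r addr0.
    by apply/funext => s; rewrite rV_cons_lift.
  + move=> v; apply: continuous_comp; first exact: continuous_rV_cons2.
    exact: dgc.
  + by move=> v k vk; apply: (g0 _ (lift ord0 k)); rewrite mxE liftK.
- rewrite -integral21_prod_meas1//; apply: integral0_eq => v _.
  rewrite /fubini_G /=.
  apply: (@integral_derive_line (fun t => g (rV_cons (t, v))) _ M) => //.
  + move=> t.
    rewrite (_ : (fun t => _) =
       (fun s : R => g (rV_cons (0, v) + s *: delta_mx 0 ord0))).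
      by apply: is_derive_line; rewrite -rV_cons_lift0.
    by apply/funext => s; rewrite -rV_cons_lift0.
  + move=> t; apply: continuous_comp; first exact: continuous_rV_cons1.
    exact: dgc.
  + by move=> t tM; apply: (g0 _ ord0); rewrite mxE unlift_none.
Unshelve. all: end_near. Qed.

End partial_integrals.

(** * Test functions and the fundamental lemma *)

Section limits_of_integrals.
Context d (T : measurableType d) {R : realType}.
Variable mu : {measure set T -> \bar R}.

(** Dominated convergence, with dominating function [C |g|]. *)
Lemma cvg_Rintegral_mul (D : set T) (g l : T -> R) (h : nat -> T -> R) (C : R) :
  measurable D -> mu.-integrable D (EFin \o g) ->
  (forall k, measurable_fun D (h k)) -> measurable_fun D l ->
  (forall k x, D x -> `|h k x| <= C) ->
  (forall x, D x -> h k x @[k --> \oo] --> l x) ->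
  \int[mu]_(x in D) (g x * h k x) @[k --> \oo] --> \int[mu]_(x in D) (g x * l x).
Proof.
move=> mD ig mh ml hC hl.
have mg : measurable_fun D g by apply/measurable_EFinP; exact: measurable_int ig.
have [|||||ig' _ cv] := @dominated_convergence _ _ _ mu D mD
  (fun k x => (g x * h k x)%:E) (fun x => (g x * l x)%:E) (fun x => (`|g x| * C)%:E).
- by move=> k; apply/measurable_EFinP; exact: measurable_funM.
- by apply/measurable_EFinP; exact: measurable_funM.
- apply: aeW => x Dx; apply: cvg_EFin; first exact: nearW.
  by apply: cvgMr; exact: hl.
- have := integrableZr mD C (integrable_norm ig).
  by [].
- apply: aeW => x k Dx; rewrite /= lee_fin normrM ler_wpM2l//.
  exact: hC.
have fin := integrable_fin_num mD ig'.
by move: cv; rewrite -(fineK fin) => /fine_cvg.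
Qed.

End limits_of_integrals.

Section bumps.
Context {R : realType} {n : nat}.
Implicit Types (a b x : 'rV[R]_n) (k : nat).

(** Each factor cuts off one end of the interval from [a] to [b], the more
sharply the larger [k] is. *)
Definition bump1 (k : nat) (a b t : R) : R := rsat (k%:R * (t - a)) * rsat (k%:R * (b - t)).

Definition bump k a b x : R := \prod_(i < n) bump1 k (a 0 i) (b 0 i) (x 0 i).

Lemma bump1_ge0 k (a b t : R) : 0 <= bump1 k a b t.
Proof. by rewrite mulr_ge0// rsat_ge0. Qed.

Lemma bump1_le1 k (a b t : R) : bump1 k a b t <= 1.
Proof. by rewrite mulr_ile1 ?rsat_ge0 ?rsat_le1. Qed.

Lemma norm_prod_le1 (r : seq 'I_n) (P : pred 'I_n) (F : 'I_n -> R) :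
  (forall i, 0 <= F i <= 1) -> `|\prod_(i <- r | P i) F i| <= 1.
Proof.
move=> F01; rewrite ger0_norm.
  by rewrite big_seq_cond; apply: prodr_ile1 => i _.
by apply: prodr_ge0 => i _; have /andP[] := F01 i.
Qed.

Lemma bump_le1 k a b x : `|bump k a b x| <= 1.
Proof. by apply: norm_prod_le1 => i; rewrite bump1_ge0 bump1_le1. Qed.

Lemma is_derive_affine (c t0 : R) t : is_derive t (1:R) (fun s : R => c * (s - t0)) c.
Proof.
have := is_deriveZ c (is_deriveB (is_derive_id t (1:R)) (is_derive_cst t0 t (1:R))).
by rewrite subr0 [_ *: 1]mulr1.
Qed.

Lemma C1_rsat_affine (c t0 : R) i :
  C1_on setT (fun x : 'rV[R]_n => rsat (c * (x 0 i - t0))).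
Proof.
apply: (@C1_comp _ _ (fun t => rsat (c * (t - t0)))
  (fun t => drsat (c * (t - t0)) * c) (fun x : 'rV[R]_n => x 0 i)).
- move=> t; apply: (@is_derive1_comp _ rsat (fun t => c * (t - t0))).
    exact: is_derive_rsat.
  exact: is_derive_affine.
- move=> t; apply: cvgM; last exact: cvg_cst.
  apply: (@continuous_comp _ _ _ (fun t => c * (t - t0)) drsat).
    by apply: cvgM; [exact: cvg_cst|apply: cvgB; [exact: cvg_id|exact: cvg_cst]].
  exact: continuous_drsat.
- exact: C1_coord.
Qed.

Lemma C1_bump1 k (a b : R) i : C1_on setT (fun x : 'rV[R]_n => bump1 k a b (x 0 i)).
Proof.
apply: C1M; first exact: C1_rsat_affine.
rewrite (_ : (fun x => _) = (fun x : 'rV[R]_n => rsat (- k%:R * (x 0 i - b)))).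
  exact: C1_rsat_affine.
by apply/funext => x; rewrite mulNr -mulrN opprB.
Qed.

Lemma C1_bump k a b : C1_on setT (bump k a b).
Proof.
apply: (@C1_prod _ _ _ _ (fun i x => bump1 k (a 0 i) (b 0 i) (x 0 i))) => i.
exact: C1_bump1.
Qed.

Lemma bump_neq0 k a b x : bump k a b x != 0 -> obox a b x.
Proof.
move=> bx i; apply/negP => abx; move/negP: bx; apply; apply/eqP.
rewrite /bump (bigD1 i)//= /bump1; move/negP : abx; rewrite negb_and -!leNgt.
move=> /orP[xa|bx].
  by rewrite rsat_eq0 ?mul0r// mulr_ge0_le0// subr_le0.
by rewrite [X in _ * X * _]rsat_eq0 ?mulr0 ?mul0r// mulr_ge0_le0// subr_le0.
Qed.

Lemma cvg_bump1 (a b t : R) :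
  bump1 k a b t @[k --> \oo] --> ((a < t < b)%R%:R : R).
Proof.
rewrite -(subr_gt0 a) -(subr_gt0 t) -mulnb natrM.
by apply: cvgM; exact: cvg_rsat.
Qed.

Lemma cvg_finite_prod (r : seq 'I_n) (P : pred 'I_n) (u : 'I_n -> nat -> R) (l : 'I_n -> R) :
  (forall i, u i k @[k --> \oo] --> l i) ->
  \prod_(i <- r | P i) u i k @[k --> \oo] --> \prod_(i <- r | P i) l i.
Proof.
move=> ul; elim: r => [|i r IH].
  by rewrite big_nil; under eq_fun do rewrite big_nil; exact: cvg_cst.
rewrite big_cons; under eq_fun do rewrite big_cons.
by case: (P i) => //; exact: cvgM.
Qed.

Lemma prod_indic_obox a b x :
  \prod_(i < n) ((a 0 i < x 0 i < b 0 i)%R%:R : R) = \1_(obox a b) x.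
Proof.
rewrite indicE; case: (pselect (obox a b x)) => abx.
  by rewrite mem_set// big1// => i _; rewrite abx.
rewrite memNset//; move: abx => /existsNP[i /negP/negPf abx].
by rewrite (bigD1 i)//= abx mul0r.
Qed.

Lemma cvg_bump a b x : bump k a b x @[k --> \oo] --> (\1_(obox a b) x : R).
Proof. by rewrite -prod_indic_obox; apply: cvg_finite_prod => i; exact: cvg_bump1. Qed.

Lemma test_fun_bump Omega k a b : cbox a b `<=` Omega -> test_fun Omega (bump k a b).
Proof.
move=> abO.
have sab : closure [set x | bump k a b x != 0] `<=` cbox a b.
  rewrite [X in _ `<=` X](proj1 (closure_id _) (@closed_cbox _ _ a b)).
  by apply: closureS => x /= /bump_neq0/sub_obox_cbox.
split; first exact: C1_bump.
- apply: (subclosed_compact _ _ sab); first exact: closed_closure.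
  by apply: bounded_closed_compact; [exact: bounded_cbox|exact: closed_cbox].
- exact: subset_trans sab abO.
Qed.

End bumps.

Section test_functions.
Context {R : realType} {N : nat}.
Variable Omega : set 'rV[R]_N.
Hypothesis oO : open Omega.
Local Notation leb := (lebesgue_rV N : {measure set 'rV[R]_N -> \bar R}).
Implicit Types (phi psi zeta : 'rV[R]_N -> R) (x : 'rV[R]_N).

Let mO : measurable Omega. Proof. exact: open_measurable_rV. Qed.

Lemma test_fun_cbox phi : test_fun Omega phi -> exists r : R, 0 <= r /\
  forall x, phi x != 0 -> cbox (const_mx (- r)) (const_mx r) x.
Proof.
move=> [_ /compact_bounded/bounded_sub_cbox[r [r0 pr]] _].
by exists r; split => // x px; apply: pr; exact: subset_closure.
Qed.

Lemma test_fun_out phi : test_fun Omega phi -> forall x, ~ Omega x -> phi x = 0.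
Proof.
move=> [_ _ pO] x Ox; apply/eqP; apply/negPn/negP => px; apply/Ox/pO.
exact: subset_closure.
Qed.

Lemma derive_eq0_off (K : set 'rV[R]_N) phi : C1_on setT phi -> closed K ->
  (forall x, phi x != 0 -> K x) ->
  forall x i, ~ K x -> 'D_(delta_mx 0 i) phi x = 0.
Proof.
move=> Cp cK pK x i Kx.
apply: (is_derive_near0 _ (C1_is_derive Cp i x)).
have nK : nbhs x (~` K) by apply: open_nbhs_nbhs; split => //; exact: closed_openC.
by apply: filterS nK => y Ky; apply/eqP/negPn/negP => /pK.
Qed.

Lemma derive_test_fun_out phi : test_fun Omega phi -> forall x i, ~ Omega x ->
  'D_(delta_mx 0 i) phi x = 0.
Proof.
move=> [Cp _ pO] x i Ox.
apply: (@derive_eq0_off (closure [set x | phi x != 0]) phi Cp).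
- exact: closed_closure.
- by move=> y py; exact: subset_closure.
- by move=> /pO.
Qed.

Lemma Rintegral_supported (h : 'rV[R]_N -> R) : (forall x, ~ Omega x -> h x = 0) ->
  \int[leb]_(x in Omega) h x = \int[leb]_x h x.
Proof.
move=> h0; rewrite Rintegral_mkcond; apply: eq_Rintegral => x _.
by rewrite patchE; case: ifPn => // /negP; rewrite inE => /h0.
Qed.

Lemma integrable_test_mul phi (h : 'rV[R]_N -> R) : test_fun Omega phi ->
  continuous h -> leb.-integrable setT (EFin \o (phi \* h)).
Proof.
move=> tp hc; have [r [r0 pr]] := test_fun_cbox tp.
apply: (@integrable_of_cbox _ _ _ (const_mx (- r)) (const_mx r)).
  by apply: continuous_mul => //; apply: C1_continuous; have [] := tp.
move=> x xr; apply/eqP; rewrite mulf_eq0; apply/orP; left.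
by apply/negPn/negP => /pr.
Qed.

Lemma integrable_derive_test_mul phi (h : 'rV[R]_N -> R) i : test_fun Omega phi ->
  continuous h -> leb.-integrable setT (EFin \o ('D_(delta_mx 0 i) phi \* h)).
Proof.
move=> tp hc; have [r [r0 pr]] := test_fun_cbox tp.
have [Cp _ _] := tp.
apply: (@integrable_of_cbox _ _ _ (const_mx (- r)) (const_mx r)).
  by apply: continuous_mul => //; exact: C1_continuous_derive.
by move=> x xr /=; rewrite (derive_eq0_off Cp (@closed_cbox _ _ _ _) pr) ?mul0r.
Qed.

(** The two integrands add up to a partial derivative of [phi \* zeta], which
inherits the bounded support of [phi]. *)
Lemma integration_by_parts_test phi zeta i : test_fun Omega phi -> C1_on setT zeta ->
  \int[leb]_(x in Omega) (phi x * 'D_(delta_mx 0 i) zeta x) =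
  - \int[leb]_(x in Omega) ('D_(delta_mx 0 i) phi x * zeta x).
Proof.
move=> tp Cz; have [Cp _ _] := tp.
rewrite !Rintegral_supported; last first.
- by move=> x Ox; rewrite (test_fun_out tp)// mul0r.
- by move=> x Ox; rewrite derive_test_fun_out// mul0r.
apply/eqP; rewrite -addr_eq0 -RintegralD//; last first.
- by apply: integrable_derive_test_mul => //; exact: C1_continuous.
- by apply: integrable_test_mul => //; exact: C1_continuous_derive.
have [r [r0 pr]] := test_fun_cbox tp.
suff E : (\int[leb]_x (phi x * 'D_(delta_mx 0 i) zeta x +
    'D_(delta_mx 0 i) phi x * zeta x)%:E = 0)%E by rewrite /Rintegral E.
apply: (@integral_partial_eq0 _ _ i (phi \* zeta) _ r) => //.
- move=> x; rewrite [X in _ + X]mulrC; apply: is_deriveM; exact: C1_is_derive.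
- apply: continuous_add; apply: continuous_mul.
  + exact: C1_continuous Cp.
  + exact: C1_continuous_derive Cz i.
  + exact: C1_continuous_derive Cp i.
  + exact: C1_continuous Cz.
- move=> x j xr; suff px : phi x = 0 by rewrite /= px mul0r.
  apply/eqP/negPn/negP => /pr/(_ j); rewrite !mxE -ler_norml.
  by rewrite leNgt xr.
Qed.

(** The fundamental lemma of the calculus of variations: the bumps are test
functions that converge to the indicators of boxes. *)
Lemma ae_eq0_of_test (g : 'rV[R]_N -> R) : leb.-integrable Omega (EFin \o g) ->
  (forall phi, test_fun Omega phi -> \int[leb]_(x in Omega) (g x * phi x) = 0) ->
  {ae leb, forall x, Omega x -> g x = 0}.
Proof.
move=> ig gphi.
have box0 a b : cbox a b `<=` Omega -> \int[leb]_(x in obox a b) g x = 0.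
  move=> abO.
  have mab := measurable_obox a b.
  have C : \int[leb]_(x in Omega) (g x * bump k a b x) @[k --> \oo] -->
      \int[leb]_(x in Omega) (g x * \1_(obox a b) x).
    apply: (@cvg_Rintegral_mul _ _ _ leb Omega g _ _ 1) => //.
    - move=> k; apply: continuous_measurable_rV => //.
      exact: C1_continuous (C1_bump k a b).
    - by move=> k x _; exact: bump_le1.
    - by move=> x _; exact: cvg_bump.
  have -> : \int[leb]_(x in obox a b) g x =
      \int[leb]_(x in Omega) (g x * \1_(obox a b) x).
    rewrite Rintegral_mkcond [RHS]Rintegral_mkcond; apply: eq_Rintegral => x _.
    rewrite !patchE indicE; have [xab|xab] := boolP (x \in obox a b).
      by rewrite mulr1 ifT//; move: xab; rewrite !inE => /sub_obox_cbox/abO.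
    by rewrite mulr0 if_same.
  have /cvg_lim <- := C; last exact: Rhausdorff.
  rewrite (_ : (fun k => _) = cst 0) ?lim_cst//.
  by apply/funext => k; apply: gphi; exact: test_fun_bump.
have box_ae a b : cbox a b `<=` Omega ->
    {ae leb, forall x, obox a b x -> g x = 0}.
  move=> abO.
  have mab := measurable_obox a b.
  have igab c d : cbox c d `<=` Omega -> leb.-integrable (obox c d) (EFin \o g).
    move=> cdO; apply: (integrableS mO) => //; first exact: measurable_obox.
    exact: subset_trans (@sub_obox_cbox _ _ _ _) cdO.
  have G0 : {ae leb, forall x, (g \_ (obox a b)) x = 0}.
    apply: (@ae_eq0_of_obox _ _ _ a b) => [||c d].
    - by rewrite -restrict_EFin; apply: (proj1 (integrable_mkcond (EFin \o g) mab)); exact: igab.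
    - by move=> x abx; rewrite patchE memNset.
    - rewrite (_ : (fun x => _) = (EFin \o g) \_ (obox a b)); last first.
        by rewrite restrict_EFin.
      rewrite -integral_mkcondr setIC oboxI.
      set e := \row_i _; set f := \row_i _.
      have efO : cbox e f `<=` Omega.
        apply: subset_trans abO => x xef i; have := xef i.
        by rewrite !mxE ge_max le_min => /andP[/andP[-> _] /andP[-> _]].
      have := box0 _ _ efO; rewrite /Rintegral => /eqP.
      rewrite fine_eq0 => [/eqP//|].
      by apply: integrable_fin_num; [exact: measurable_obox|exact: igab].
  by apply: filterS G0 => x + xab; rewrite patchE mem_set.
(* Countably many boxes with rational corners cover [Omega]. *)
have H : {ae leb, forall x, forall k : nat,
    if unpickle k is Some q then
      cbox (map_mx ratr (q : 'rV[rat]_N * 'rV[rat]_N).1) (map_mx ratr q.2) `<=` Omega ->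
      obox (map_mx ratr q.1) (map_mx ratr q.2) x -> g x = 0 else True}.
  apply: ae_foralln => k; case: unpickle => [q|]; last exact: aeW.
  have [qO|qO] := pselect (cbox (map_mx ratr q.1) (map_mx ratr q.2) `<=` Omega).
    by apply: filterS (box_ae _ _ qO) => x + _.
  by apply: aeW.
apply: filterS H => x Hx Ox.
have [q [xq qO]] := open_rational_box oO Ox.
by have := Hx (pickle q); rewrite pickleK; apply.
Qed.

End test_functions.

(** * The Euclidean norm and the flux of the p-Laplacian *)

Section euclidean_norm.
Context {R : realType} {N : nat}.
Implicit Types (a b : 'rV[R]_N) (c : R).

Lemma dotrVC a b : dotrV a b = dotrV b a.
Proof. by apply: eq_bigr => i _; rewrite mulrC. Qed.

Lemma dotrVDl a b d : dotrV (a + b) d = dotrV a d + dotrV b d.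
Proof. by rewrite -big_split; apply: eq_bigr => i _; rewrite mxE mulrDl. Qed.

Lemma dotrVZl c a b : dotrV (c *: a) b = c * dotrV a b.
Proof. by rewrite /dotrV mulr_sumr; apply: eq_bigr => i _; rewrite mxE mulrA. Qed.

Lemma dotrVNl a b : dotrV (- a) b = - dotrV a b.
Proof. by rewrite -scaleN1r dotrVZl mulN1r. Qed.

Lemma dotrVDr a b d : dotrV d (a + b) = dotrV d a + dotrV d b.
Proof. by rewrite dotrVC dotrVDl !(dotrVC d). Qed.

Lemma dotrVZr c a b : dotrV a (c *: b) = c * dotrV a b.
Proof. by rewrite dotrVC dotrVZl dotrVC. Qed.

Lemma dotrVNr a b : dotrV a (- b) = - dotrV a b.
Proof. by rewrite dotrVC dotrVNl dotrVC. Qed.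

Lemma dotrV_ge0 a : 0 <= dotrV a a.
Proof. by apply: sumr_ge0 => i _; rewrite -expr2 sqr_ge0. Qed.

Lemma dotrV_eq0 a : dotrV a a = 0 -> a = 0.
Proof.
move=> /eqP; rewrite psumr_eq0 => [/allP a0|i _]; last by rewrite -expr2 sqr_ge0.
apply/rowP => i; rewrite mxE; apply/eqP.
by have := a0 i; rewrite mem_index_enum mulf_eq0 orbb => /(_ isT).
Qed.

Lemma enorm_ge0 a : 0 <= enorm a.
Proof. exact: sqrtr_ge0. Qed.

Lemma enorm_sqr a : enorm a ^+ 2 = dotrV a a.
Proof. by rewrite sqr_sqrtr// dotrV_ge0. Qed.

Lemma enorm_eq0 a : enorm a = 0 -> a = 0.
Proof. by move=> a0; apply: dotrV_eq0; rewrite -enorm_sqr a0 expr0n. Qed.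

Lemma enorm0 : enorm (0 : 'rV[R]_N) = 0.
Proof. by rewrite /enorm /dotrV big1 ?sqrtr0// => i _; rewrite mxE mul0r. Qed.

Lemma enormZ c a : enorm (c *: a) = `|c| * enorm a.
Proof. by rewrite /enorm dotrVZl dotrVZr mulrA -expr2 sqrtrM ?sqr_ge0// sqrtr_sqr. Qed.

Lemma cauchy_schwarz a b : `|dotrV a b| <= enorm a * enorm b.
Proof.
rewrite -(@ler_pXn2r _ 2) ?nnegrE ?mulr_ge0 ?enorm_ge0//.
rewrite real_normK ?num_real// exprMn !enorm_sqr.
have := dotrV_ge0 (dotrV b b *: a - dotrV a b *: b).
rewrite !(dotrVDl, dotrVDr, dotrVZl, dotrVZr, dotrVNl, dotrVNr) (dotrVC b a).
have := dotrV_ge0 b; rewrite le_eqVlt => /predU1P[/esym/dotrV_eq0 ->|].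
  have z x : dotrV x 0 = 0 by rewrite /dotrV big1// => i _; rewrite mxE mulr0.
  by move=> _; rewrite (z _ _ a) (z _ _ 0) mulr0 expr0n lexx.
move: (dotrV a a) (dotrV b b) (dotrV a b) => A B C B0 h.
rewrite -subr_ge0 -(pmulr_rge0 _ B0).
by apply: le_trans h _; rewrite le_eqVlt; apply/orP; left; apply/eqP; ring.
Qed.

Lemma enorm_triangle a b : enorm (a + b) <= enorm a + enorm b.
Proof.
rewrite -(@ler_pXn2r _ 2) ?nnegrE ?addr_ge0 ?enorm_ge0//.
rewrite enorm_sqr sqrrD !enorm_sqr !(dotrVDl, dotrVDr) (dotrVC b a).
have := le_trans (ler_norm _) (cauchy_schwarz a b).
move: (enorm a * enorm b) => ab; lra.
Qed.

Lemma norm_coord_le_enorm a i : `|a 0 i| <= enorm a.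
Proof.
rewrite -sqrtr_sqr ler_sqrt ?dotrV_ge0// /dotrV (bigD1 i)//= expr2 lerDl.
by apply: sumr_ge0 => j _; rewrite -expr2 sqr_ge0.
Qed.

Lemma enorm_le_sum a : enorm a <= \sum_i `|a 0 i|.
Proof.
rewrite -(@ler_pXn2r _ 2) ?nnegrE ?enorm_ge0 ?sumr_ge0//.
rewrite enorm_sqr expr2 mulr_suml; apply: ler_sum => i _.
rewrite -expr2 -real_normK ?num_real// expr2 ler_wpM2l//.
by rewrite (bigD1 i)//= lerDl sumr_ge0.
Qed.

Lemma pflux_dot (p : R) a : 1 < p -> dotrV (pflux p a) a = enorm a `^ p.
Proof.
move=> p1; rewrite /pflux dotrVZl -enorm_sqr.
have [->|a0] := eqVneq (enorm a) 0.
  by rewrite expr0n mulr0 powR0// gt_eqF// (lt_trans _ p1).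
rewrite -powR_mulrn ?enorm_ge0// -powRD ?a0 ?implybT//.
by congr (_ `^ _); ring.
Qed.

Lemma enorm_pflux (p : R) a : 1 < p -> enorm (pflux p a) = enorm a `^ (p - 1).
Proof.
move=> p1; rewrite /pflux enormZ ger0_norm ?powR_ge0//.
have [->|a0] := eqVneq (enorm a) 0.
  by rewrite mulr0 powR0// gt_eqF// subr_gt0.
rewrite -[X in _ * X]powRr1 ?enorm_ge0// -powRD ?a0 ?implybT//.
by congr (_ `^ _); ring.
Qed.

(** A crude form of Young's inequality: the product [|a|^(p-1) |b|] is at most the
p-th power of the larger norm. *)
Lemma norm_pflux_dot_le (p : R) a b : 1 < p ->
  `|dotrV (pflux p a) b| <= enorm a `^ p + enorm b `^ p.
Proof.
move=> p1; have p0 : 0 < p by rewrite (lt_trans _ p1).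
have p10 : 0 <= p - 1 by rewrite subr_ge0 ltW.
apply: le_trans (cauchy_schwarz _ _) _; rewrite enorm_pflux//.
have na := enorm_ge0 a; have nb := enorm_ge0 b.
have [ab|/ltW ba] := leP (enorm a) (enorm b).
  apply: (@le_trans _ _ (enorm b `^ p)); last by rewrite lerDr powR_ge0.
  by rewrite mulrC -(mulr_powRB1 nb p0) ler_wpM2l// ge0_ler_powR.
apply: (@le_trans _ _ (enorm a `^ p)); last by rewrite lerDl powR_ge0.
by rewrite mulrC -(mulr_powRB1 na p0) ler_wpM2r// powR_ge0.
Qed.

(** By Cauchy-Schwarz, the monotonicity of the flux reduces to that of the scalar
map [s |-> s^(p-1)] at the two norms. *)
Let pflux_lower (p : R) a b : 1 < p ->
  (enorm a `^ (p - 1) - enorm b `^ (p - 1)) * (enorm a - enorm b) <=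
  dotrV (pflux p a - pflux p b) (a - b).
Proof.
move=> p1; have p0 : 0 < p by rewrite (lt_trans _ p1).
rewrite !(dotrVDl, dotrVDr, dotrVNl, dotrVNr) !pflux_dot//.
have ab := le_trans (ler_norm _) (cauchy_schwarz (pflux p a) b).
have ba := le_trans (ler_norm _) (cauchy_schwarz (pflux p b) a).
rewrite !enorm_pflux// in ab ba.
rewrite -(mulr_powRB1 (enorm_ge0 a) p0) -(mulr_powRB1 (enorm_ge0 b) p0).
move: ab ba; set A := _ `^ _; set B := _ `^ _.
move: (enorm a) (enorm b) (dotrV _ b) (dotrV _ a) => x y s t ab ba.
rewrite -subr_ge0; nra.
Qed.

Lemma pflux_monotone (p : R) a b : 1 < p ->
  0 <= dotrV (pflux p a - pflux p b) (a - b).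
Proof.
move=> p1; apply: le_trans (pflux_lower a b p1).
have p10 : 0 <= p - 1 by rewrite subr_ge0 ltW.
have na := enorm_ge0 a; have nb := enorm_ge0 b.
have [ab|/ltW ba] := leP (enorm a) (enorm b).
  by rewrite mulr_le0// subr_le0// ge0_ler_powR.
by rewrite mulr_ge0// subr_ge0// ge0_ler_powR.
Qed.

(** By [pflux_lower] the norms agree, and then the difference of the fluxes is a
multiple of [a - b]. *)
Lemma pflux_strict (p : R) a b : 1 < p ->
  dotrV (pflux p a - pflux p b) (a - b) = 0 -> a = b.
Proof.
move=> p1 ab0.
have p10 : 0 < p - 1 by rewrite subr_gt0.
have na := enorm_ge0 a; have nb := enorm_ge0 b.
have nab : enorm a = enorm b.
  have := pflux_lower a b p1; rewrite ab0.
  have [ab|ba|//] := ltgtP (enorm a) (enorm b).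
    rewrite leNgt nmulr_rgt0 ?subr_lt0 ?ab//.
    by rewrite gt0_ltr_powR.
  by rewrite leNgt mulr_gt0// subr_gt0// gt0_ltr_powR.
move: ab0; rewrite /pflux nab -scalerBr dotrVZl => /eqP.
rewrite mulf_eq0 => /orP[|/eqP/dotrV_eq0/eqP]; last by rewrite subr_eq0 => /eqP.
rewrite powR_eq0 => /andP[/eqP b0 _].
by rewrite (enorm_eq0 b0); apply: enorm_eq0; rewrite nab.
Qed.

End euclidean_norm.

(** * Functions of class L^p *)

Section powers.
Context {R : realType}.
Implicit Types (x y t p : R).

Lemma powR_add_le p x y : 0 <= p -> 0 <= x -> 0 <= y ->
  (x + y) `^ p <= 2 `^ p * (x `^ p + y `^ p).
Proof.
move=> p0 x0 y0; have two : 0 <= 2 :> R by [].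
have [xy|/ltW yx] := leP x y.
  apply: (@le_trans _ _ ((2 * y) `^ p)).
    rewrite ge0_ler_powR ?nnegrE ?addr_ge0 ?mulr_ge0//.
    by rewrite mulr_natl mulr2n lerD2r.
  by rewrite powRM// ler_wpM2l ?powR_ge0// lerDr powR_ge0.
apply: (@le_trans _ _ ((2 * x) `^ p)).
  rewrite ge0_ler_powR ?nnegrE ?addr_ge0 ?mulr_ge0//.
  by rewrite mulr_natl mulr2n lerD2l.
by rewrite powRM// ler_wpM2l ?powR_ge0// lerDl powR_ge0.
Qed.

(** The first term suffices below [delta] and the second above it. This bounds an
L^1 norm by an L^p energy, as Hoelder's inequality would. *)
Lemma le_powR_trunc p (delta : R) t : 1 <= p -> 0 < delta -> 0 <= t ->
  t <= delta + delta * delta^-1 `^ p * t `^ p.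
Proof.
move=> p1 d0 t0; rewrite -mulrA -powRM ?invr_ge0 ?(ltW d0)//.
rewrite -[X in X + _]mulr1 -mulrDr -ler_pdivrMl//.
have : 0 <= delta^-1 * t by rewrite mulr_ge0// invr_ge0 ltW.
move: (_ * t) => s s0; have [s1|/ltW s1] := leP s 1.
  by rewrite (le_trans s1)// lerDl powR_ge0.
by rewrite (le_trans (le1r_powR s1 p1))// lerDr.
Qed.

End powers.

Section lebesgue_spaces.
Context {R : realType} {N : nat}.
Variable Omega : set 'rV[R]_N.
Hypothesis oO : open Omega.
Hypothesis bO : bounded_set Omega.
Variable p : R.
Hypothesis p1 : 1 < p.
Local Notation leb := (lebesgue_rV N : {measure set 'rV[R]_N -> \bar R}).
Implicit Types (u v phi : 'rV[R]_N -> R) (G : 'rV[R]_N -> 'rV[R]_N).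

Let mO : measurable Omega. Proof. exact: open_measurable_rV. Qed.

Let p0 : 0 < p. Proof. by rewrite (lt_trans _ p1). Qed.

Lemma integrable_le (g h : 'rV[R]_N -> R) : measurable_fun Omega g ->
  (forall x, Omega x -> `|g x| <= h x) -> leb.-integrable Omega (EFin \o h) ->
  leb.-integrable Omega (EFin \o g).
Proof.
move=> mg gh ih; apply: le_integrable ih => //.
  exact/measurable_EFinP.
by move=> x Ox /=; rewrite lee_fin (le_trans (gh _ Ox))// ler_norm.
Qed.

(** The same functions as in [Lp_on], the finiteness of the norm being expressed
by an integral over [Omega]; see [Lp_onP]. *)
Definition Lp u : Prop :=
  measurable_fun Omega u /\ leb.-integrable Omega (EFin \o (fun x => `|u x| `^ p)).

Lemma measurable_of_Lp_on (r : \bar R) u : Lp_on Omega r u -> measurable_fun Omega u.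
Proof.
move=> /andP[]; rewrite inE => /= mu _.
by apply/(measurable_restrictT _ mO); exact: mu.
Qed.

Lemma Lp_onP u : Lp_on Omega p%:E u <-> Lp u.
Proof.
have E : (fun x => (`|(u \_ Omega) x| `^ p)%:E) =
    (EFin \o (fun x => `|u x| `^ p)) \_ Omega.
  apply/funext => x; rewrite !patchE; case: ifP => //= _.
  by rewrite normr0 powR0// gt_eqF.
split=> [Lu|[mu iu]].
  split; first exact: measurable_of_Lp_on Lu.
  apply/integrable_mkcond => //; rewrite -E.
  by apply: Lfun_integrable => //; exact: ltW.
have iu' := proj1 (integrable_mkcond _ mO) iu.
rewrite /Lp_on; apply/andP; split; rewrite inE /=.
  by apply/(measurable_restrictT _ mO).
rewrite /finite_norm unlock /Lnorm /=.
apply: poweR_lty.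
have := integrable_lty measurableT iu'; rewrite -E.
by under eq_integral do rewrite -poweR_EFin.
Qed.

Lemma Lp_integrable u : Lp u -> leb.-integrable Omega (EFin \o u).
Proof.
move=> [mu iu]; apply: (@integrable_le _ (fun x => 1 + `|u x| `^ p)) => //.
  move=> x _; have [u1|/ltW u1] := leP `|u x| 1.
    by rewrite (le_trans u1)// lerDl powR_ge0.
  by rewrite (le_trans (le1r_powR u1 (ltW p1)))// lerDr.
rewrite (_ : _ \o _ = (EFin \o cst 1%R) \+ (EFin \o (fun x => `|u x| `^ p)%R))%E//.
apply: integrableD => //.
apply: measurable_bounded_integrable => //; first exact: bounded_lty.
by exists 1; split; [exact: num_real|move=> t t1 x _ /=; rewrite normr1 ltW].
Qed.

Lemma measurable_powR_norm u : measurable_fun Omega u ->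
  measurable_fun Omega (fun x => `|u x| `^ p).
Proof.
move=> mu; apply: (measurableT_comp (measurable_powR _)).
exact: measurableT_comp.
Qed.

Lemma Lp_le u (h : 'rV[R]_N -> R) : measurable_fun Omega u ->
  (forall x, Omega x -> `|u x| `^ p <= h x) -> leb.-integrable Omega (EFin \o h) ->
  Lp u.
Proof.
move=> mu uh ih; split => //; apply: integrable_le ih.
  exact: measurable_powR_norm.
by move=> x Ox; rewrite ger0_norm ?powR_ge0// uh.
Qed.

Lemma LpD u v : Lp u -> Lp v -> Lp (u \+ v).
Proof.
move=> [mu iu] [mv iv].
apply: (@Lp_le _ (fun x => 2 `^ p * (`|u x| `^ p + `|v x| `^ p))).
- exact: measurable_funD.
- move=> x _; apply: le_trans (powR_add_le _ _ _) => //; last exact: ltW.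
  by rewrite ge0_ler_powR ?nnegrE ?addr_ge0 ?ler_normD// ltW.
- by have := integrableZl mO (2 `^ p) (integrableD mO iu iv).
Qed.

Lemma LpM_bounded u (h : 'rV[R]_N -> R) (M : R) : Lp u -> measurable_fun Omega h ->
  (forall x, Omega x -> `|h x| <= M) -> Lp (fun x => h x * u x).
Proof.
move=> [mu iu] mh hM.
apply: (@Lp_le _ (fun x => M `^ p * `|u x| `^ p)).
- exact: measurable_funM.
- move=> x Ox; rewrite normrM powRM// ler_wpM2r ?powR_ge0//.
  by rewrite ge0_ler_powR ?nnegrE ?(ltW p0)// ?hM// (le_trans _ (hM x Ox)).
- by have := integrableZl mO (M `^ p) iu.
Qed.

Lemma LpN u : Lp u -> Lp (fun x => - u x).
Proof.
move=> Lu; rewrite (_ : (fun x => _) = (fun x => -1 * u x)); last first.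
  by apply/funext => x; rewrite mulN1r.
apply: (LpM_bounded (M := 1) Lu) => // x _.
by rewrite normrN1.
Qed.

Lemma Lp_bounded u (M : R) : measurable_fun Omega u ->
  (forall x, Omega x -> `|u x| <= M) -> Lp u.
Proof.
move=> mu uM; apply: (@Lp_le _ (fun=> M `^ p)) => //.
  move=> x Ox; have := uM x Ox => h.
  by rewrite ge0_ler_powR ?nnegrE ?(ltW p0)// (le_trans _ h).
apply: measurable_bounded_integrable => //; first exact: bounded_lty.
exists (`|M `^ p|); split; first exact: num_real.
by move=> t t1 x _ /=; rewrite ltW.
Qed.

Lemma Lp_continuous u : continuous u -> Lp u.
Proof.
move=> uc; have [M [_ uM]] := continuous_bounded_on uc bO.
by apply: (@Lp_bounded _ M) => //; exact: continuous_measurable_rV.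
Qed.

Lemma measurable_dotrV G G' : (forall i, measurable_fun Omega (fun x => G x 0 i)) ->
  (forall i, measurable_fun Omega (fun x => G' x 0 i)) ->
  measurable_fun Omega (fun x => dotrV (G x) (G' x)).
Proof.
move=> mG mG'; apply: measurable_sum => i.
by apply: measurable_funM.
Qed.

Lemma measurable_enorm G : (forall i, measurable_fun Omega (fun x => G x 0 i)) ->
  measurable_fun Omega (fun x => enorm (G x)).
Proof.
move=> mG; apply: (measurableT_comp (continuous_measurable_fun (@sqrt_continuous R))).
exact: measurable_dotrV.
Qed.

Lemma Lp_enorm G : (forall i, Lp (fun x => G x 0 i)) -> Lp (fun x => enorm (G x)).
Proof.
move=> LG.
have mG i : measurable_fun Omega (fun x => G x 0 i) by have [] := LG i.
have LS : Lp (fun x => \sum_i `|G x 0 i|).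
  elim: (index_enum _) => [|i r IH].
    rewrite (_ : (fun x => _) = cst 0).
      by apply: (@Lp_bounded _ 0) => // x _; rewrite normr0.
    by apply/funext => x; rewrite big_nil.
  rewrite (_ : (fun x => _) =
      (fun x => `|G x 0 i|) \+ (fun x => \sum_(i <- r) `|G x 0 i|)); last first.
    by apply/funext => x; rewrite big_cons.
  apply: LpD => //; have [mGi iGi] := LG i.
  apply: (Lp_le _ _ iGi); first exact: measurableT_comp.
  by move=> x _; rewrite normr_id.
apply: (Lp_le _ _ LS.2); first exact: measurable_enorm.
move=> x _; rewrite ge0_ler_powR ?nnegrE ?(ltW p0)//.
rewrite ger0_norm ?enorm_ge0// (le_trans (enorm_le_sum _))//.
exact: ler_norm.
Qed.

Definition energy u G (x : 'rV[R]_N) : R := `|u x| `^ p + enorm (G x) `^ p.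

Lemma energy_ge0 u G x : 0 <= energy u G x.
Proof. by rewrite addr_ge0 ?powR_ge0. Qed.

Lemma integrable_energy u G : Lp u -> (forall i, Lp (fun x => G x 0 i)) ->
  leb.-integrable Omega (EFin \o energy u G).
Proof.
move=> [_ iu] LG; have [_ iG] := Lp_enorm LG.
have := integrableD mO iu iG; apply: eq_integrable => // x _ /=.
by rewrite (ger0_norm (enorm_ge0 _)).
Qed.

Lemma integrable_bounded_mul u (h : 'rV[R]_N -> R) : Lp u -> continuous h ->
  leb.-integrable Omega (EFin \o (fun x => u x * h x)).
Proof.
move=> Lu hc; have [M [_ hM]] := continuous_bounded_on hc bO.
have /Lp_integrable := LpM_bounded Lu (continuous_measurable_rV hc mO) hM.
by rewrite (_ : (fun x => h x * u x) = (fun x => u x * h x))//; apply/funext => x; rewrite mulrC.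
Qed.

End lebesgue_spaces.

(** * Weak gradients of limits of test functions *)

Section sobolev_functions.
Context {R : realType} {N : nat}.
Variable Omega : set 'rV[R]_N.
Hypothesis oO : open Omega.
Hypothesis bO : bounded_set Omega.
Variable p : R.
Hypothesis p1 : 1 < p.
Local Notation leb := (lebesgue_rV N : {measure set 'rV[R]_N -> \bar R}).
Local Notation Lp := (Lp Omega p).
Local Notation energy := (energy p).
Implicit Types (u v phi zeta : 'rV[R]_N -> R) (G : 'rV[R]_N -> 'rV[R]_N).

Let mO : measurable Omega. Proof. exact: open_measurable_rV. Qed.

Let p0 : 0 < p. Proof. by rewrite (lt_trans _ p1). Qed.

(** [u] is the limit of test functions whose gradients converge to [G]. As no weak
derivative occurs here, the closure properties of W_0^{1,p} can be read off the
approximating test functions; [W01p_strong_grad] and [strong_grad_W01p] translate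
between the two descriptions. *)
Definition strong_grad u G : Prop := [/\ Lp u, forall i, Lp (fun x => G x 0 i) &
  forall e : R, 0 < e -> exists2 phi, test_fun Omega phi &
    (\int[leb]_(x in Omega)
      (energy (fun x => u x - phi x) (fun x => G x - cgrad phi x) x)%:E < e%:E)%E].

Lemma test_fun_Lp phi : test_fun Omega phi ->
  Lp phi /\ forall i, Lp (fun x => cgrad phi x 0 i).
Proof.
move=> [Cphi _ _]; split; first by apply: Lp_continuous => //; exact: C1_continuous.
move=> i; rewrite (_ : (fun x => _) = 'D_(delta_mx 0 i) phi).
  by apply: Lp_continuous => //; exact: C1_continuous_derive.
by apply/funext => x; rewrite mxE.
Qed.

Lemma Lp_grad_sub G G' : (forall i, Lp (fun x => G x 0 i)) ->
  (forall i, Lp (fun x => G' x 0 i)) -> forall i, Lp (fun x => (G x - G' x) 0 i).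
Proof.
move=> LG LG' i; have := LpD oO p1 (LG i) (LpN oO p1 (LG' i)).
by congr Lp; apply/funext => x; rewrite !mxE.
Qed.

(** Makes the integral of [g] small with the energy of [(u, G)]: [delta] is to be
chosen first, and then the bound [e] on the energy. *)
Lemma norm_Rintegral_le_energy (g : 'rV[R]_N -> R) (M delta e : R) u G :
  0 <= M -> 0 < delta ->
  Lp u -> (forall i, Lp (fun x => G x 0 i)) ->
  (\int[leb]_(x in Omega) (energy u G x)%:E < e%:E)%E ->
  measurable_fun Omega g ->
  (forall x, Omega x -> `|g x| <= M * (`|u x| + enorm (G x))) ->
  `|\int[leb]_(x in Omega) g x| <=
    M * (2 * delta * fine (leb Omega) + delta * delta^-1 `^ p * e).
Proof.
move=> M0 d0 Lu LG Ee mg gM.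
set c := delta * _.
have c0 : 0 <= c by rewrite mulr_ge0 ?powR_ge0// ltW.
have iE := integrable_energy oO bO p1 Lu LG.
have icst (r : R) : leb.-integrable Omega (EFin \o cst r).
  apply: measurable_bounded_integrable => //; first exact: bounded_lty.
  exists `|r|; split; first exact: num_real.
  by move=> t rt x _ /=; exact: ltW.
pose h x := M * (2 * delta) + M * c * energy u G x.
have ih : leb.-integrable Omega (EFin \o h).
  have := integrableD mO (icst (M * (2 * delta))) (integrableZl mO (M * c) iE).
  by [].
have gh x : Omega x -> `|g x| <= h x.
  move=> Ox; apply: le_trans (gM _ Ox) _.
  rewrite /h -mulrA -mulrDr ler_wpM2l//.
  have hu := le_powR_trunc (ltW p1) d0 (normr_ge0 (u x)).
  have hG := le_powR_trunc (ltW p1) d0 (enorm_ge0 (G x)).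
  apply: le_trans (lerD hu hG) _.
  rewrite -/c /energy le_eqVlt; apply/orP; left; apply/eqP; ring.
have ig : leb.-integrable Omega (EFin \o g) by exact: integrable_le ih.
apply: le_trans (le_normr_Rintegral mO ig) _.
apply: le_trans (le_Rintegral mO (integrable_norm ig) ih gh) _.
clearbody c; rewrite /h RintegralD//; [|exact: (icst (M * (2 * delta)))|by have := integrableZl mO (M * c) iE].
rewrite Rintegral_cst// RintegralZl// mulrDr !mulrA lerD2l ler_wpM2l ?(mulr_ge0 M0 c0)//.
rewrite -lee_fin /Rintegral fineK; first exact: ltW.
exact: integrable_fin_num.
Qed.

(** The formula holds for test functions and passes to the limit. It has no
boundary term although [zeta] may be nonzero on the boundary: this is the trace
of [u] being zero. *)
Lemma strong_grad_by_parts u G zeta i : strong_grad u G -> C1_on setT zeta ->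
  \int[leb]_(x in Omega) (u x * 'D_(delta_mx 0 i) zeta x) =
  - \int[leb]_(x in Omega) (G x 0 i * zeta x).
Proof.
move=> [Lu LG apx] Cz.
have zc := C1_continuous Cz; have dzc := @C1_continuous_derive _ _ _ Cz i.
have [M1 [M10 hM1]] := continuous_bounded_on zc bO.
have [M2 [M20 hM2]] := continuous_bounded_on dzc bO.
pose M := M1 + M2.
have M0 : 0 <= M by rewrite addr_ge0.
apply/eqP; rewrite -addr_eq0 -normr_le0; apply/ler_addgt0Pl => eps eps0.
rewrite addr0.
pose L := fine (leb Omega).
have L0 : 0 <= L by rewrite fine_ge0.
(* For these [delta] and [e] each of the two error terms is at most [eps / 2]. *)
pose delta := eps / (4 * (M + 1) * (L + 1)).
have K0 : 0 < 4 * (M + 1) * (L + 1).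
  by rewrite !mulr_gt0// ltr_wpDl.
have d0 : 0 < delta by rewrite divr_gt0.
pose c := delta * delta^-1 `^ p.
have c0 : 0 < c by rewrite mulr_gt0// powR_gt0// invr_gt0.
pose e := eps / (2 * (M + 1) * c).
have M1p : 0 < M + 1 by rewrite ltr_wpDl.
have e0 : 0 < e.
  apply: (divr_gt0 eps0); apply: mulr_gt0 c0; exact: mulr_gt0.
have [phi tp Ephi] := apx e e0.
have [Lphi Ldphi] := test_fun_Lp tp.
have [Cphi _ _] := tp.
pose w x := u x - phi x.
pose H x := G x - cgrad phi x.
have Lw : Lp w by have := LpD oO p1 Lu (LpN oO p1 Lphi).
have LH := Lp_grad_sub LG Ldphi : forall i, Lp (fun x => H x 0 i).
have IB (g h : 'rV[R]_N -> R) : Lp g -> continuous h ->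
  leb.-integrable Omega (EFin \o (fun x => g x * h x)).
  by move=> Lg hc; exact: (integrable_bounded_mul oO bO p1 Lg hc).
have E : \int[leb]_(x in Omega) (u x * 'D_(delta_mx 0 i) zeta x) +
    \int[leb]_(x in Omega) (G x 0 i * zeta x) =
    \int[leb]_(x in Omega) (w x * 'D_(delta_mx 0 i) zeta x + H x 0 i * zeta x).
  rewrite RintegralD//; [|exact: IB|exact: IB].
  have -> : \int[leb]_(x in Omega) (u x * 'D_(delta_mx 0 i) zeta x) =
     \int[leb]_(x in Omega) (w x * 'D_(delta_mx 0 i) zeta x) +
     \int[leb]_(x in Omega) (phi x * 'D_(delta_mx 0 i) zeta x).
    rewrite -RintegralD//; [|exact: IB|exact: IB].
    by apply: eq_Rintegral => x _; rewrite -mulrDl subrK.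
  have -> : \int[leb]_(x in Omega) (G x 0 i * zeta x) =
     \int[leb]_(x in Omega) (H x 0 i * zeta x) +
     \int[leb]_(x in Omega) (cgrad phi x 0 i * zeta x).
    rewrite -RintegralD//; [|exact: IB|exact: IB].
    by apply: eq_Rintegral => x _; rewrite -mulrDl !mxE subrK.
  rewrite (integration_by_parts_test i tp Cz).
  under [X in _ + (_ + X)]eq_Rintegral do rewrite mxE.
  by rewrite addrACA addNr addr0.
rewrite E.
apply: le_trans (norm_Rintegral_le_energy M0 d0 Lw LH Ephi _ _) _.
- apply: measurable_funD; apply: measurable_funM.
  + exact: Lw.1.
  + exact: continuous_measurable_rV.
  + exact: (LH i).1.
  + exact: continuous_measurable_rV.
- move=> x Ox; apply: le_trans (ler_normD _ _) _; rewrite mulrDr !normrM.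
  apply: lerD; rewrite mulrC.
    by rewrite ler_wpM2r// (le_trans (hM2 x Ox))// lerDr.
  apply: ler_pM => //; last exact: norm_coord_le_enorm.
  by rewrite (le_trans (hM1 x Ox))// lerDl.
rewrite -/L -/c.
apply: (@le_trans _ _ ((M + 1) * (2 * delta * (L + 1) + c * e))).
  have mono (d K : R) : 0 <= d -> 0 <= K ->
      M * (2 * d * L + K) <= (M + 1) * (2 * d * (L + 1) + K).
    move=> dge0 K0'; have := mulr_ge0 dge0 L0; have := mulr_ge0 dge0 M0.
    move: (M) (L) => M' L' dM dL; lra.
  by apply: mono; [exact: ltW|exact: ltW (mulr_gt0 c0 e0)].
rewrite le_eqVlt; apply/orP; left; apply/eqP.
have M1n : M + 1 != 0 by rewrite gt_eqF// ltr_wpDl.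
have L1n : L + 1 != 0 by rewrite gt_eqF// ltr_wpDl.
have cn : c != 0 by rewrite gt_eqF.
rewrite /e /delta; move: (c) (M) (L) M1n L1n cn => c' M' L' M1n L1n cn.
by field; rewrite cn M1n L1n.
Qed.

Lemma strong_grad_is_weak_grad u G : strong_grad u G -> is_weak_grad Omega p u G.
Proof.
move=> sG; have [_ LG _] := sG; split=> [i|phi tp i].
  by apply/(Lp_onP oO p1); exact: LG.
by apply: strong_grad_by_parts => //; have [] := tp.
Qed.

Lemma weak_grad_unique u G G' :
  is_weak_grad Omega p u G -> is_weak_grad Omega p u G' ->
  {ae leb, forall x, Omega x -> G x = G' x}.
Proof.
move=> [LG wG] [LG' wG'].
have H : {ae leb, forall x (i : 'I_N), Omega x -> G x 0 i - G' x 0 i = 0}.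
  apply: filter_forall => i.
  have /(Lp_onP oO p1) Li := LG i; have /(Lp_onP oO p1) Li' := LG' i.
  have LD : Lp (fun x => G x 0 i - G' x 0 i).
    by have := LpD oO p1 Li (LpN oO p1 Li').
  apply: ae_eq0_of_test => //; first exact: (Lp_integrable oO bO p1).
  move=> phi tp.
  have pc : continuous phi by apply: C1_continuous; have [] := tp.
  transitivity (\int[leb]_(x in Omega) (G x 0 i * phi x - G' x 0 i * phi x)).
    by apply: eq_Rintegral => x _; rewrite mulrBl.
  rewrite RintegralB//; [|exact: (integrable_bounded_mul oO bO p1 Li pc)|exact: (integrable_bounded_mul oO bO p1 Li' pc)].
  by apply/eqP; rewrite subr_eq0 -eqr_opp -wG// -wG'.
apply: filterS H => x Hx Ox; apply/rowP => i; apply/eqP.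
by rewrite -subr_eq0 Hx.
Qed.

Lemma is_weak_grad_wgrad u : W1p Omega p u ->
  is_weak_grad Omega p u (wgrad Omega p u).
Proof.
by move=> [_ ex]; rewrite /wgrad; case: xgetP => [G ->//|none]; case: ex => G /none.
Qed.

Lemma W01p_strong_grad u : W01p Omega p u -> strong_grad u (wgrad Omega p u).
Proof.
move=> [W apx]; have [/(Lp_onP oO p1) Lu _] := W.
split => // i; have [LG _] := is_weak_grad_wgrad W.
by apply/(Lp_onP oO p1).
Qed.

(** The chosen representative [wgrad] agrees with [G] because weak gradients are
unique. *)
Lemma strong_grad_W01p u G : strong_grad u G ->
  W01p Omega p u /\ {ae leb, forall x, Omega x -> wgrad Omega p u x = G x}.
Proof.
move=> sG; have [Lu LG apx] := sG.
have wG := strong_grad_is_weak_grad sG.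
have W : W1p Omega p u by split; [exact/(Lp_onP oO p1)|exists G].
have wG' := is_weak_grad_wgrad W.
have E := weak_grad_unique wG' wG.
split; last exact: E.
split; first exact: W.
move=> e e0; have [phi tp Ephi] := apx e e0.
exists phi; first exact: tp.
suff EQ : (\int[leb]_(x in Omega) (energy (fun x => u x - phi x)
      (fun x => wgrad Omega p u x - cgrad phi x) x)%:E =
    \int[leb]_(x in Omega) (energy (fun x => u x - phi x)
      (fun x => G x - cgrad phi x) x)%:E)%E.
  by rewrite -EQ in Ephi; exact: Ephi.
have [Lphi Ldphi] := test_fun_Lp tp.
have Lw : Lp (fun x => u x - phi x) by have := LpD oO p1 Lu (LpN oO p1 Lphi).
have LG' i : Lp (fun x => wgrad Omega p u x 0 i).
  by have [h _] := wG'; apply/(Lp_onP oO p1).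
apply: ge0_ae_eq_integral => //.
- exact: measurable_int (integrable_energy oO bO p1 Lw (Lp_grad_sub LG' Ldphi)).
- exact: measurable_int (integrable_energy oO bO p1 Lw (Lp_grad_sub LG Ldphi)).
- by move=> x _; rewrite lee_fin energy_ge0.
- by move=> x _; rewrite lee_fin energy_ge0.
- by apply: filterS E => x Ex Ox; rewrite /energy Ex.
Qed.

End sobolev_functions.

(** * C^1 functions whose derivative approximates the indicator of a box *)

Section sweeps.
Context {R : realType} {n : nat}.
Implicit Types (a b x : 'rV[R]_n) (k : nat).

Lemma cvg_rsatS (s : R) : rsat (k.+1%:R * s) @[k --> \oo] --> ((0 < s)%R%:R : R).
Proof. by have := @cvg_rsat R s; rewrite -cvg_shiftS. Qed.

(** The indicator of the interval from [a] to [b] is the sum of those of the two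
half-lines [t > a] and [t < b], minus 1. Approximating the latter by [rsat] gives
[dramp], of which [ramp] is a primitive. *)
Definition ramp (k : nat) (a b t : R) : R :=
  (rint (k.+1%:R * (t - a)) - rint (- k.+1%:R * (t - b))) * k.+1%:R^-1 - t.

Definition dramp (k : nat) (a b t : R) : R :=
  rsat (k.+1%:R * (t - a)) + rsat (- k.+1%:R * (t - b)) - 1.

Lemma is_derive_ramp k (a b t : R) : is_derive t (1:R) (ramp k a b) (dramp k a b t).
Proof.
have D (c t0 : R) : is_derive t (1:R) (fun s => rint (c * (s - t0))) (rsat (c * (t - t0)) * c).
  apply: (@is_derive1_comp _ rint (fun s => c * (s - t0))).
    exact: is_derive_rint.
  exact: is_derive_affine.
have D1 := is_deriveB (D k.+1%:R a) (D (- k.+1%:R) b).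
have D2 := is_deriveM D1 (is_derive_cst (k.+1%:R^-1 : R) t (1:R)).
have D3 := is_deriveB D2 (is_derive_id t (1:R)).
move: D3; set v := (X in is_derive _ _ _ X -> _).
suff -> : dramp k a b t = v by [].
rewrite /v.
rewrite /dramp scaler0 add0r /GRing.scale /=; field.
by rewrite addrC natr1 pnatr_eq0.
Qed.

Lemma continuous_dramp k (a b : R) : continuous (dramp k a b).
Proof.
have aff (c t0 : R) : continuous (fun t : R => rsat (c * (t - t0))).
  move=> t; apply: (@continuous_comp _ _ _ (fun t => c * (t - t0)) rsat).
    by apply: cvgM; [exact: cvg_cst|apply: cvgB; [exact: cvg_id|exact: cvg_cst]].
  exact: continuous_rsat.
move=> t; apply: cvgB; last exact: cvg_cst.
by apply: cvgD; exact: aff.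
Qed.

Lemma norm_dramp_le1 k (a b t : R) : `|dramp k a b t| <= 1.
Proof.
rewrite /dramp; set s := _ * (t - a); set s' := _ * (t - b).
have := rsat_ge0 s; have := rsat_le1 s; have := rsat_ge0 s'; have := rsat_le1 s'.
by move=> *; rewrite ler_norml; apply/andP; split; lra.
Qed.

Lemma cvg_dramp (a b t : R) : a < b ->
  dramp k a b t @[k --> \oo] --> ((a < t < b)%R%:R : R).
Proof.
move=> ab; rewrite (_ : (_ < t < _)%R%:R = (0 < t - a)%R%:R + (0 < b - t)%R%:R - 1 :> R).
  apply: cvgB; last exact: cvg_cst.
  apply: cvgD; first exact: cvg_rsatS.
  rewrite (_ : (fun k => _) = (fun k => rsat (k.+1%:R * (b - t)))).
    exact: cvg_rsatS.
  by apply/funext => k; rewrite mulNr -mulrN opprB.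
rewrite !subr_gt0; have [ta|at'] := leP t a.
  by rewrite (le_lt_trans ta ab) add0r subrr.
by case: (t < b); rewrite /= ?addr0 ?subrr ?addrK.
Qed.

(** A primitive, in the direction [i0], of an approximate indicator of the box. It
does not have compact support, but [strong_grad_by_parts] does not ask for it. *)
Definition sweep k a b i0 x : R := ramp k (a 0 i0) (b 0 i0) (x 0 i0) *
  \prod_(i < n | i != i0) bump1 k.+1 (a 0 i) (b 0 i) (x 0 i).

Lemma C1_sweep k a b i0 : C1_on setT (sweep k a b i0).
Proof.
apply: C1M.
  apply: (@C1_comp _ _ (ramp k (a 0 i0) (b 0 i0)) (dramp k (a 0 i0) (b 0 i0)) (fun x : 'rV[R]_n => x 0 i0)).
  - exact: is_derive_ramp.
  - exact: continuous_dramp.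
  - exact: C1_coord.
apply: (@C1_prod _ _ _ _ (fun i x => bump1 k.+1 (a 0 i) (b 0 i) (x 0 i))) => i.
exact: C1_bump1.
Qed.

Lemma derive_sweep k a b i0 x : 'D_(delta_mx 0 i0) (sweep k a b i0) x =
  dramp k (a 0 i0) (b 0 i0) (x 0 i0) *
  \prod_(i < n | i != i0) bump1 k.+1 (a 0 i) (b 0 i) (x 0 i).
Proof.
pose P (y : 'rV[R]_n) : R := \prod_(i < n | i != i0) bump1 k.+1 (a 0 i) (b 0 i) (y 0 i).
have D1 : is_derive x (delta_mx 0 i0)
    (fun y : 'rV[R]_n => ramp k (a 0 i0) (b 0 i0) (y 0 i0))
    (dramp k (a 0 i0) (b 0 i0) (x 0 i0)).
  have := @is_derive_comp1 _ _ (ramp k (a 0 i0) (b 0 i0)) (fun y : 'rV[R]_n => y 0 i0)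
    x (delta_mx 0 i0) _ _ (is_derive_ramp k _ _ _) (is_derive_coord i0 i0 x).
  by rewrite eqxx mulr1.
have D2 : is_derive x (delta_mx 0 i0) P 0.
  apply: is_derive_invariant => s; apply: eq_bigr => i ii0.
  by rewrite !mxE (negPf ii0) /= mulr0 addr0.
have [_ ->] := is_deriveM D1 D2.
by rewrite scaler0 add0r /GRing.scale /= mulrC.
Qed.

Lemma norm_derive_sweep k a b i0 x : `|'D_(delta_mx 0 i0) (sweep k a b i0) x| <= 1.
Proof.
rewrite derive_sweep normrM mulr_ile1 ?norm_dramp_le1//.
by apply: norm_prod_le1 => i; rewrite bump1_ge0 bump1_le1.
Qed.

Lemma cvg_derive_sweep a b i0 x : a 0 i0 < b 0 i0 ->
  'D_(delta_mx 0 i0) (sweep k a b i0) x @[k --> \oo] --> (\1_(obox a b) x : R).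
Proof.
move=> ab; under eq_fun do rewrite derive_sweep.
rewrite -prod_indic_obox (bigD1 i0)//=.
apply: cvgM; first exact: cvg_dramp.
apply: (@cvg_finite_prod _ _ _ _ (fun i k => bump1 k.+1 (a 0 i) (b 0 i) (x 0 i))) => i.
by have := @cvg_bump1 R (a 0 i) (b 0 i) (x 0 i); rewrite -cvg_shiftS.
Qed.

End sweeps.

(** * Closure properties of W_0^{1,p} and Poincare inequality *)

Section sobolev_closure.
Context {R : realType} {N : nat}.
Variable Omega : set 'rV[R]_N.
Hypothesis oO : open Omega.
Hypothesis bO : bounded_set Omega.
Variable p : R.
Hypothesis p1 : 1 < p.
Local Notation leb := (lebesgue_rV N : {measure set 'rV[R]_N -> \bar R}).
Local Notation Lp := (Lp Omega p).
Local Notation energy := (energy p).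
Implicit Types (u v phi zeta : 'rV[R]_N -> R) (G : 'rV[R]_N -> 'rV[R]_N).

Let mO : measurable Omega. Proof. exact: open_measurable_rV. Qed.

Let p0 : 0 < p. Proof. by rewrite (lt_trans _ p1). Qed.

Local Notation strong_grad := (strong_grad Omega p).

Lemma energy_ltP u G (e : R) : Lp u -> (forall i, Lp (fun x => G x 0 i)) ->
  (\int[leb]_(x in Omega) (energy u G x)%:E < e%:E)%E <->
  \int[leb]_(x in Omega) energy u G x < e.
Proof.
move=> Lu LG; rewrite -lte_fin /Rintegral fineK//.
by apply: integrable_fin_num => //; exact: (integrable_energy oO bO p1).
Qed.

Lemma test_fun_closed phi (K : set 'rV[R]_N) : C1_on setT phi -> compact K ->
  K `<=` Omega -> (forall x, phi x != 0 -> K x) -> test_fun Omega phi.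
Proof.
move=> Cp cK KO pK.
have clK : closed K by apply: compact_closed => //; exact: norm_hausdorff.
have sK : closure [set x | phi x != 0] `<=` K.
  by rewrite [X in _ `<=` X](proj1 (closure_id _) clK); exact: closureS.
split => //; last exact: subset_trans sK KO.
by apply: (subclosed_compact _ cK sK); exact: closed_closure.
Qed.

Lemma test_fun_lin (c : R) phi psi : test_fun Omega phi -> test_fun Omega psi ->
  test_fun Omega (fun x => phi x + c * psi x).
Proof.
move=> [C1p cp pO] [C2p cq qO].
apply: (@test_fun_closed _ (closure [set x | phi x != 0] `|`
  closure [set x | psi x != 0])).
- exact: (C1D C1p (C1M (C1_cst c) C2p)).
- exact: compactU.
- by move=> x [/pO|/qO].
- move=> x; have [->|p0'] := eqVneq (phi x) 0; last by move=> _; left; exact: subset_closure.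
  rewrite add0r mulf_eq0 negb_or => /andP[_ q0]; right; exact: subset_closure.
Qed.

Lemma cgrad_lin (c : R) phi psi x : test_fun Omega phi -> test_fun Omega psi ->
  cgrad (fun x => phi x + c * psi x) x = cgrad phi x + c *: cgrad psi x.
Proof.
move=> [C1p _ _] [C2p _ _]; apply/rowP => i; rewrite !mxE.
have d1 := C1_is_derive C1p i x.
have d2 := is_deriveZ c (C1_is_derive C2p i x).
by have [] := is_deriveD d1 d2.
Qed.

Lemma Lp_lin (c : R) u v : Lp u -> Lp v -> Lp (fun x => u x + c * v x).
Proof.
move=> Lu Lv; apply: (LpD oO p1 Lu).
by apply: (LpM_bounded oO p1 (M := `|c|) Lv).
Qed.

(** The cases of interest are sums and differences; for [|c| <= 1] the same
constant [2^p] serves both terms. *)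
Lemma strong_grad_lin (c : R) u v G H : `|c| <= 1 -> strong_grad u G -> strong_grad v H ->
  strong_grad (fun x => u x + c * v x) (fun x => G x + c *: H x).
Proof.
move=> c1 [Lu LG apu] [Lv LH apv].
have LS i : Lp (fun x => (G x + c *: H x) 0 i).
  have := Lp_lin c (LG i) (LH i).
  by congr Lp; apply/funext => x; rewrite !mxE.
split; [exact: Lp_lin Lu Lv|exact: LS|move=> e e0].
have K0 : 0 < 2 `^ p :> R by rewrite powR_gt0.
have e'0 : 0 < e / (2 * 2 `^ p) by rewrite divr_gt0// mulr_gt0.
have [phi tp Ep] := apu _ e'0; have [psi tq Eq] := apv _ e'0.
have [Lp' Ldp] := test_fun_Lp oO bO p1 tp.
have [Lq Ldq] := test_fun_Lp oO bO p1 tq.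
have tpq := test_fun_lin c tp tq.
have [Lpq Ldpq] := test_fun_Lp oO bO p1 tpq.
have Lw1 : Lp (fun x => u x - phi x) by have := LpD oO p1 Lu (LpN oO p1 Lp').
have Lw2 : Lp (fun x => v x - psi x) by have := LpD oO p1 Lv (LpN oO p1 Lq).
have Lw3 : Lp (fun x => u x + c * v x - (phi x + c * psi x)).
  by have := LpD oO p1 (Lp_lin c Lu Lv) (LpN oO p1 Lpq).
have LG1 := Lp_grad_sub oO p1 LG Ldp.
have LG2 := Lp_grad_sub oO p1 LH Ldq.
have LG3 := Lp_grad_sub oO p1 LS Ldpq.
move/(energy_ltP _ Lw1 LG1) : Ep => Ep; move/(energy_ltP _ Lw2 LG2) : Eq => Eq.
exists (fun x => phi x + c * psi x); first exact: tpq.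
apply/(energy_ltP _ Lw3 LG3).
have i1 := integrable_energy oO bO p1 Lw1 LG1.
have i2 := integrable_energy oO bO p1 Lw2 LG2.
have i3 := integrable_energy oO bO p1 Lw3 LG3.
have i12 := integrableD mO i1 i2.
have i12' := integrableZl mO (2 `^ p) i12.
apply: le_lt_trans (le_Rintegral mO i3 i12' _) _.
  move=> x _ /=; rewrite /energy (cgrad_lin c x tp tq).
  have -> : u x + c * v x - (phi x + c * psi x) = (u x - phi x) + c * (v x - psi x).
    by ring.
  have -> : G x + c *: H x - (cgrad phi x + c *: cgrad psi x) =
      (G x - cgrad phi x) + c *: (H x - cgrad psi x).
    by rewrite scalerBr opprD addrACA.
  set s := u x - _; set t := v x - _; set a := G x - _; set b := H x - _.
  have pos : 0 <= p by exact: ltW.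
  have h1 : `|s + c * t| `^ p <= 2 `^ p * (`|s| `^ p + `|t| `^ p).
    apply: le_trans (powR_add_le pos (normr_ge0 _) (normr_ge0 _)).
    rewrite ge0_ler_powR ?nnegrE ?addr_ge0// (le_trans (ler_normD _ _))//.
    by rewrite lerD2l normrM ler_piMl.
  have h2 : enorm (a + c *: b) `^ p <= 2 `^ p * (enorm a `^ p + enorm b `^ p).
    apply: le_trans (powR_add_le pos (enorm_ge0 _) (enorm_ge0 _)).
    rewrite ge0_ler_powR ?nnegrE ?addr_ge0 ?enorm_ge0// (le_trans (enorm_triangle _ _))//.
    by rewrite lerD2l enormZ ler_piMl ?enorm_ge0.
  by apply: le_trans (lerD h1 h2) _; rewrite -mulrDr addrACA.
rewrite RintegralZl; [|exact: mO|exact: i12].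
rewrite RintegralD; [|exact: mO|exact: i1|exact: i2].
have E : e = 2 `^ p * (e / (2 * 2 `^ p) + e / (2 * 2 `^ p)).
  by field; rewrite gt_eqF.
by rewrite [ltRHS]E ltr_pM2l// ltrD.
Qed.

Lemma test_fun_rint phi : test_fun Omega phi -> test_fun Omega (rint \o phi).
Proof.
move=> [Cp cp pO]; apply: (@test_fun_closed _ (closure [set x | phi x != 0])) => //.
  by apply: C1_comp Cp; [exact: is_derive_rint|exact: continuous_rsat].
move=> x rx; apply: subset_closure => /=; apply: contra rx => /eqP px.
by rewrite /= px rint0.
Qed.

Lemma cgrad_rint phi x : test_fun Omega phi ->
  cgrad (rint \o phi) x = rsat (phi x) *: cgrad phi x.
Proof.
move=> [Cp _ _]; apply/rowP => i; rewrite !mxE.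
by rewrite (derive_comp1 (@is_derive_rint R) Cp).
Qed.

Lemma measurable_rV_comp (F : R -> R) u : continuous F -> measurable_fun Omega u ->
  measurable_fun Omega (F \o u).
Proof.
by move=> Fc mu; apply: measurableT_comp => //; exact: continuous_measurable_fun.
Qed.

(** Dominated convergence: the indicators of the sets where [g > k] tend to 0
pointwise. *)
Lemma integral_tail (g : 'rV[R]_N -> R) (e : R) : Lp g -> 0 < e ->
  exists k : nat, \int[leb]_(x in Omega)
    (`|g x| `^ p * \1_(Omega `&` g @^-1` `]k%:R, +oo[) x) < e.
Proof.
move=> [mg ig] e0.
have C : \int[leb]_(x in Omega) (`|g x| `^ p * \1_(Omega `&` g @^-1` `]k%:R, +oo[) x)
   @[k --> \oo] --> \int[leb]_(x in Omega) (`|g x| `^ p * 0).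
  apply: (@cvg_Rintegral_mul _ _ _ leb Omega _ (cst 0) _ 1) => //.
  - move=> k; apply: measurable_funTS; apply: measurable_indic.
    by apply: mg => //; exact: measurable_itv.
  - by move=> k x _; rewrite indicE; case: (_ \in _); rewrite /= ?normr1 ?normr0.
  - move=> x _; apply: cvg_near_cst; near=> k.
    rewrite indicE memNset//= => -[_]; rewrite in_itv/= andbT => kg.
    have : g x < k%:R.
      apply: (lt_le_trans (truncnS_gt _)); rewrite ler_nat.
      near: k; exact: nbhs_infty_ge.
    by move=> /(lt_trans kg); rewrite ltxx.
have Z : \int[leb]_(x in Omega) (`|g x| `^ p * 0) = 0.
  by rewrite (_ : (fun x => _) = cst 0) ?Rintegral_cst ?mul0r//; apply/funext => x; rewrite mulr0.
rewrite Z in C; move/cvgrPdist_lt : C => /(_ e e0)[k _ /(_ k (leqnn k))].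
by rewrite sub0r normrN => /(le_lt_trans (ler_norm _)); exists k.
Unshelve. all: end_near. Qed.

(** If [phi] is close to [u], the gradient of [rint \o phi] differs from [rsat u G]
by [rsat phi (G - grad phi)], which is small with [G - grad phi], and by
[(rsat u - rsat phi) G]. Where [|G| <= K] the latter is at most [K |u - phi|], as
[rsat] is Lipschitz; elsewhere it is at most [|G|], whose tail is small for large
[K] by [integral_tail]. *)
Lemma strong_grad_rint u G : strong_grad u G ->
  strong_grad (rint \o u) (fun x => rsat (u x) *: G x).
Proof.
move=> [Lu LG apx].
have mu := Lu.1.
have mr := measurable_rV_comp (@continuous_rsat R) mu.
have Lr : Lp (rint \o u).
  apply: (Lp_le oO _ _ Lu.2); first exact: measurable_rV_comp (@continuous_rint R) mu.
  by move=> x _; rewrite ge0_ler_powR ?nnegrE ?(ltW p0)// norm_rint_le.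
have LS i : Lp (fun x => (rsat (u x) *: G x) 0 i).
  rewrite (_ : (fun x => _) = (fun x => (rsat \o u) x * G x 0 i)); last first.
    by apply/funext => x; rewrite mxE.
  apply: (LpM_bounded oO p1 (M := 1) (LG i)) => // x _ /=.
  by rewrite ger0_norm ?rsat_ge0// rsat_le1.
split; [exact: Lr|exact: LS|move=> e e0].
have Lg := Lp_enorm oO bO p1 LG.
set g := (fun x => enorm (G x)) in Lg.
have T0 : 0 < 2 `^ p :> R by rewrite powR_gt0.
have [k kP] := integral_tail Lg (divr_gt0 e0 (mulr_gt0 (@ltr0Sn R 1) (mulr_gt0 T0 T0))).
set h := (fun x => _) in kP.
set K : R := k%:R.
pose C : R := 1 + 2 `^ p * 2 `^ p * K `^ p + 2 `^ p.
have C0 : 0 < C.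
  have B0 : 0 <= 2 `^ p * 2 `^ p * K `^ p by rewrite !mulr_ge0 ?powR_ge0.
  by apply: addr_gt0 T0; apply: ltr_pwDl B0.
have e'0 : 0 < e / (2 * C) by rewrite divr_gt0// mulr_gt0.
have [phi tp Ep] := apx _ e'0.
have [Lp' Ldp] := test_fun_Lp oO bO p1 tp.
have tr := test_fun_rint tp.
have [Lr' Ldr] := test_fun_Lp oO bO p1 tr.
have Lw : Lp (fun x => u x - phi x) by have := LpD oO p1 Lu (LpN oO p1 Lp').
have Lw2 : Lp (fun x => (rint \o u) x - (rint \o phi) x).
  by have := LpD oO p1 Lr (LpN oO p1 Lr').
have LG1 := Lp_grad_sub oO p1 LG Ldp.
have LG2 := Lp_grad_sub oO p1 LS Ldr.
move/(energy_ltP _ Lw LG1) : Ep => Ep.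
exists (rint \o phi); first exact: tr.
apply/(energy_ltP _ Lw2 LG2).
have i1 := integrable_energy oO bO p1 Lw LG1.
have i2 := integrable_energy oO bO p1 Lw2 LG2.
have ih : leb.-integrable Omega (EFin \o h).
  apply: (integrable_le oO _ _ Lg.2).
    apply: measurable_funM; first exact: measurable_powR_norm Lg.1.
    apply: measurable_funTS; apply: measurable_indic.
    by apply: Lg.1 => //; exact: measurable_itv.
  move=> x _; rewrite normrM ger0_norm ?powR_ge0// ler_piMr ?powR_ge0//.
  by rewrite indicE; case: (_ \in _); rewrite /= ?normr1 ?normr0.
have ib := integrableD mO (integrableZl mO C i1) (integrableZl mO (2 `^ p * 2 `^ p) ih).
apply: le_lt_trans (le_Rintegral mO i2 ib _) _.
  move=> x Ox /=; rewrite /energy (cgrad_rint x tp) /=.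
  have pos : 0 <= p by exact: ltW.
  set w := u x - phi x; set a := G x - cgrad phi x.
  have h1 : `|rint (u x) - rint (phi x)| `^ p <= `|w| `^ p.
    by rewrite ge0_ler_powR ?nnegrE// contraction_rint.
  pose t : R := g x * \1_(Omega `&` g @^-1` `]k%:R, +oo[) x.
  have g0 : 0 <= g x by exact: enorm_ge0.
  have t0 : 0 <= t by rewrite mulr_ge0// indicE.
  have K0 : 0 <= K by [].
  have h2 : enorm (rsat (u x) *: G x - rsat (phi x) *: cgrad phi x) <=
      (K * `|w| + t) + enorm a.
    have -> : rsat (u x) *: G x - rsat (phi x) *: cgrad phi x =
        (rsat (u x) - rsat (phi x)) *: G x + rsat (phi x) *: a.
      by rewrite /a scalerBl scalerBr addrA subrK.
    apply: le_trans (enorm_triangle _ _) _; rewrite !enormZ; apply: lerD; last first.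
      by rewrite ler_piMl ?enorm_ge0// ger0_norm ?rsat_ge0// rsat_le1.
    rewrite -/(g x) /t indicE.
    have [xk|xk] := boolP (x \in _).
      rewrite mulr1 ler_wpDl ?mulr_ge0// ler_piMl//.
      have := rsat_ge0 (u x); have := rsat_le1 (u x).
      have := rsat_ge0 (phi x); have := rsat_le1 (phi x).
      by rewrite ler_norml; lra.
    rewrite mulr0 addr0 mulrC; apply: ler_pM => //; last exact: contraction_rsat.
    rewrite leNgt; apply: contra xk => kg; rewrite inE; split => //=.
    by rewrite in_itv/= andbT.
  have h3 : enorm (rsat (u x) *: G x - rsat (phi x) *: cgrad phi x) `^ p <=
      2 `^ p * (2 `^ p * (K `^ p * `|w| `^ p + h x) + enorm a `^ p).
    have Kw : 0 <= K * `|w| by rewrite mulr_ge0.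
    apply: (@le_trans _ _ (((K * `|w| + t) + enorm a) `^ p)).
      by rewrite ge0_ler_powR ?nnegrE ?enorm_ge0// !addr_ge0// enorm_ge0.
    apply: le_trans (powR_add_le pos (addr_ge0 Kw t0) (enorm_ge0 _)) _.
    rewrite ler_wpM2l ?powR_ge0// lerD2r.
    apply: le_trans (powR_add_le pos Kw t0) _.
    rewrite ler_wpM2l ?powR_ge0// powRM// lerD2l /h /t.
    rewrite (ger0_norm g0) indicE; case: (_ \in _); first by rewrite !mulr1.
    by rewrite !mulr0 powR0// gt_eqF.
  apply: le_trans (lerD h1 h3) _.
  have T0' := ltW T0; rewrite /C -subr_ge0.
  rewrite [leRHS](_ : _ = enorm a `^ p +
    2 `^ p * (2 `^ p * K `^ p * enorm a `^ p + `|w| `^ p)); last by ring.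
  by rewrite !(addr_ge0, mulr_ge0)// powR_ge0.
rewrite RintegralD; [|exact: mO|exact: (integrableZl mO C i1)|
  exact: (integrableZl mO (2 `^ p * 2 `^ p) ih)].
rewrite !RintegralZl; [|exact: mO|exact: ih|exact: mO|exact: i1].
have E : e = C * (e / (2 * C)) + 2 `^ p * 2 `^ p * (e / (2 * (2 `^ p * 2 `^ p))).
  by field; rewrite !gt_eqF.
by rewrite [ltRHS]E ltrD// ltr_pM2l// mulr_gt0.
Qed.

Lemma strong_grad0 : strong_grad (fun=> 0) (fun=> 0).
Proof.
have L0 : Lp (fun=> 0) by apply: (@Lp_bounded _ _ _ oO bO _ p1 _ 0) => // x _; rewrite normr0.
have t0 : test_fun Omega (fun=> 0).
  apply: (@test_fun_closed _ set0); [exact: C1_cst|exact: compact0|by []|].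
  by move=> x; rewrite eqxx.
split; [exact: L0| |].
  by move=> i; move: L0; congr Lp; apply/funext => x; rewrite mxE.
move=> e e0; exists (fun=> 0); first exact: t0.
rewrite integral0_eq ?lte_fin// => x _.
have cg0 : cgrad (fun=> 0) x = 0 :> 'rV[R]_N.
  apply/rowP => i; rewrite !mxE.
  by have [] := @is_derive_cst R _ _ (0:R) x (delta_mx 0 i).
by rewrite /energy cg0 !subr0 normr0 enorm0 powR0 ?addr0// gt_eqF.
Qed.

(** Poincare's inequality in its qualitative form. Integrating by parts against
[sweep] shows that the integral of [u] over every box is 0. *)
Lemma strong_grad_eq0 (i0 : 'I_N) u G : strong_grad u G ->
  {ae leb, forall x, Omega x -> G x = 0} -> {ae leb, forall x, Omega x -> u x = 0}.
Proof.
move=> sG G0; have [Lu LG _] := sG.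
have iu := Lp_integrable oO bO p1 Lu.
have by0 zeta : C1_on setT zeta ->
    \int[leb]_(x in Omega) (u x * 'D_(delta_mx 0 i0) zeta x) = 0.
  move=> Cz; rewrite (strong_grad_by_parts oO bO p1 i0 sG Cz).
  have iG := integrable_bounded_mul oO bO p1 (LG i0) (C1_continuous Cz).
  rewrite /Rintegral (@ae_eq_integral _ _ _ _ _ (cst 0%E)) ?integral_cst ?mul0e ?oppr0//.
    exact: measurable_int iG.
  by apply: filterS G0 => x + Ox => /(_ Ox) ->; rewrite mxE mul0r.
have box0 c d : \int[leb]_(x in Omega) (u x * \1_(obox c d) x) = 0.
  have [cd|dc] := ltP (c 0 i0) (d 0 i0); last first.
    rewrite (_ : obox c d = set0); last first.
      by apply/seteqP; split => // x /(_ i0) /andP[/lt_trans h /h]; rewrite ltNge dc.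
    rewrite (_ : (fun x => _) = cst 0) ?Rintegral_cst ?mul0r//.
    by apply/funext => x; rewrite indic0 mulr0.
  have C : \int[leb]_(x in Omega) (u x * 'D_(delta_mx 0 i0) (sweep k c d i0) x)
      @[k --> \oo] --> \int[leb]_(x in Omega) (u x * \1_(obox c d) x).
    apply: (@cvg_Rintegral_mul _ _ _ leb Omega u _ _ 1 mO iu).
    - move=> k; apply: continuous_measurable_rV => //.
      exact: (@C1_continuous_derive _ _ _ (C1_sweep k c d i0) i0).
    - by apply: measurable_funTS; apply: measurable_indic; exact: measurable_obox.
    - by move=> k x _; exact: norm_derive_sweep.
    - by move=> x _; exact: cvg_derive_sweep.
  have /cvg_lim <- := C; last exact: Rhausdorff.
  rewrite (_ : (fun k => _) = cst 0) ?lim_cst//.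
  by apply/funext => k; apply: by0; exact: C1_sweep.
have [r [r0 Or]] := bounded_sub_cbox bO.
have U0 : {ae leb, forall x, (u \_ Omega) x = 0}.
  apply: (@ae_eq0_of_obox _ _ _ (const_mx (- (r + 1))) (const_mx (r + 1))) => [||c d].
  - by rewrite -restrict_EFin; exact: (proj1 (integrable_mkcond (EFin \o u) mO)).
  - move=> x xr; rewrite patchE memNset// => /Or xr'; apply: xr => i.
    have := xr' i; rewrite !mxE => /andP[h1 h2]; apply/andP; split.
      by rewrite (lt_le_trans _ h1)// ltrN2 ltrDl.
    by rewrite (le_lt_trans h2)// ltrDl.
  - have mcd := measurable_obox c d.
    rewrite (_ : (fun x => _) = (EFin \o u) \_ Omega); last first.
      by rewrite restrict_EFin.
    rewrite -integral_mkcondr setIC integral_mkcondr.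
    have := box0 c d; rewrite /Rintegral => /eqP.
    rewrite fine_eq0.
      move=> /eqP E; rewrite -[RHS]E; apply: eq_integral => x _.
      rewrite patchE indicE; case: (_ \in _); first by rewrite mulr1.
      by rewrite mulr0.
    apply: integrable_fin_num => //.
    apply: (integrable_le oO _ _ (integrable_norm iu)).
      apply: measurable_funM; first exact: Lu.1.
      by apply: measurable_funTS; exact: measurable_indic.
    move=> x _ /=; rewrite normrM ler_piMr//.
    by rewrite indicE; case: (_ \in _); rewrite /= ?normr1 ?normr0.
by apply: filterS U0 => x + Ox; rewrite patchE mem_set.
Qed.

End sobolev_closure.

(** * Comparison for the p-Laplacian and for the obstacle problem *)

Section p_laplacian.
Context {R : realType} {N : nat}.
Variable Omega : set 'rV[R]_N.
Hypothesis oO : open Omega.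
Hypothesis bO : bounded_set Omega.
Variable p : R.
Hypothesis p1 : 1 < p.
Local Notation leb := (lebesgue_rV N : {measure set 'rV[R]_N -> \bar R}).
Local Notation Lp := (Lp Omega p).
Local Notation energy := (energy p).
Implicit Types (u v phi zeta : 'rV[R]_N -> R) (G : 'rV[R]_N -> 'rV[R]_N).

Let mO : measurable Omega. Proof. exact: open_measurable_rV. Qed.

Let p0 : 0 < p. Proof. by rewrite (lt_trans _ p1). Qed.

Local Notation strong_grad := (strong_grad Omega p).
Local Notation W01p := (W01p Omega p).
Local Notation wgrad := (wgrad Omega p).
Local Notation p_form := (p_form Omega p).

Lemma Lp_wgrad u : W01p u -> forall i, Lp (fun x => wgrad u x 0 i).
Proof. by move=> /(W01p_strong_grad oO p1)[]. Qed.

Lemma W01p_Lp u : W01p u -> Lp u.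
Proof. by move=> /(W01p_strong_grad oO p1)[]. Qed.

Lemma measurable_pflux G i : (forall i, Lp (fun x => G x 0 i)) ->
  measurable_fun Omega (fun x => pflux p (G x) 0 i).
Proof.
move=> LG; rewrite (_ : (fun x => _) = (fun x => enorm (G x) `^ (p - 2) * G x 0 i)).
  apply: measurable_funM; last exact: (LG i).1.
  apply: (measurableT_comp (measurable_powR _)).
  by apply: measurable_enorm => j; exact: (LG j).1.
by apply/funext => x; rewrite /pflux mxE.
Qed.

Lemma integrable_pflux G (H : 'rV[R]_N -> 'rV[R]_N) : (forall i, Lp (fun x => G x 0 i)) ->
  (forall i, Lp (fun x => H x 0 i)) ->
  leb.-integrable Omega (EFin \o (fun x => dotrV (pflux p (G x)) (H x))).
Proof.
move=> LG LH; have LeG := Lp_enorm oO bO p1 LG; have LeH := Lp_enorm oO bO p1 LH.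
apply: (integrable_le oO _ _ (integrableD mO LeG.2 LeH.2)).
  apply: measurable_dotrV => i; first exact: measurable_pflux.
  exact: (LH i).1.
move=> x _ /=; rewrite !(ger0_norm (enorm_ge0 _)).
exact: norm_pflux_dot_le.
Qed.

Lemma p_formE u v (H : 'rV[R]_N -> 'rV[R]_N) : W01p u -> strong_grad v H ->
  p_form u v = \int[leb]_(x in Omega) dotrV (pflux p (wgrad u x)) (H x).
Proof.
move=> Wu sv; have [Wv E] := strong_grad_W01p oO bO p1 sv.
have [_ LH _] := sv.
rewrite /p_form /Rintegral; congr fine; apply: ae_eq_integral.
- exact: mO.
- exact: measurable_int (integrable_pflux (Lp_wgrad Wu) (Lp_wgrad Wv)).
- exact: measurable_int (integrable_pflux (Lp_wgrad Wu) LH).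
- by apply: filterS E => x + Ox => /(_ Ox) ->.
Qed.

Lemma ae_eq0_of_Rintegral (g : 'rV[R]_N -> R) : leb.-integrable Omega (EFin \o g) ->
  (forall x, Omega x -> 0 <= g x) -> \int[leb]_(x in Omega) g x <= 0 ->
  {ae leb, forall x, Omega x -> g x = 0}.
Proof.
move=> ig g0 gle; have mg := measurable_int _ ig.
have Z : (\int[leb]_(x in Omega) `|(EFin \o g) x| = 0)%E.
  rewrite (eq_integral (EFin \o g)); last first.
    by move=> x; rewrite inE => Ox /=; rewrite ger0_norm// g0.
  have := integrable_fin_num mO ig; rewrite fin_numElt => /andP[_ _].
  have g1 : (0 <= \int[leb]_(x in Omega) (EFin \o g) x)%E.
    by apply: integral_ge0 => x Ox; rewrite lee_fin g0.
  apply/eqP; rewrite eq_le g1 andbT -(fineK (integrable_fin_num mO ig)) lee_fin.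
  exact: gle.
have := proj1 (ae_eq_integral_abs leb mO mg) Z.
by apply: filterS => x + Ox => /(_ Ox) [].
Qed.

Lemma W01p_lin (c : R) u v : `|c| <= 1 -> W01p u -> W01p v ->
  strong_grad (fun x => u x + c * v x) (fun x => wgrad u x + c *: wgrad v x).
Proof.
by move=> c1 Wu Wv; apply: (strong_grad_lin oO bO p1 c1); exact: W01p_strong_grad.
Qed.

Lemma W01pD u v : W01p u -> W01p v -> W01p (fun x => u x + v x).
Proof.
move=> Wu Wv.
have c1 : `|1 : R| <= 1 by rewrite normr1.
have [W _] := strong_grad_W01p oO bO p1 (W01p_lin c1 Wu Wv).
by move: W; congr (Defs.W01p _ _); apply/funext => x; rewrite mul1r.
Qed.

Lemma strong_gradB u v : W01p u -> W01p v ->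
  strong_grad (fun x => u x - v x) (fun x => wgrad u x - wgrad v x).
Proof.
move=> Wu Wv.
have c1 : `|-1 : R| <= 1 by rewrite normrN1.
have := W01p_lin c1 Wu Wv.
congr strong_grad; apply/funext => x; first by rewrite mulN1r.
by rewrite scaleN1r.
Qed.

Variable i0 : 'I_N.

(** The core of both comparison and uniqueness. The hypothesis on the gradient of
[v] turns the difference of the two forms at [v] into the integral of a
nonnegative function, by monotonicity of the flux. So that function is null, and
strict monotonicity makes the gradient of [v] vanish, hence [v] as well. *)
Lemma monotone_test_eq0 u1 u2 v (rho : 'rV[R]_N -> R) : W01p u1 -> W01p u2 ->
  (forall x, 0 <= rho x) ->
  strong_grad v (fun x => rho x *: (wgrad u1 x - wgrad u2 x)) ->
  p_form u1 v <= p_form u2 v -> {ae leb, forall x, Omega x -> v x = 0}.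
Proof.
move=> W1 W2 rho0 sv; have [_ LH _] := sv.
set H := (fun x => _) in sv LH *.
have i1 := integrable_pflux (Lp_wgrad W1) LH.
have i2 := integrable_pflux (Lp_wgrad W2) LH.
rewrite (p_formE W1 sv) (p_formE W2 sv) -subr_le0.
rewrite -RintegralB; [|exact: mO|exact: i1|exact: i2] => le0.
have Eq x : dotrV (pflux p (wgrad u1 x)) (H x) - dotrV (pflux p (wgrad u2 x)) (H x) =
    rho x * dotrV (pflux p (wgrad u1 x) - pflux p (wgrad u2 x)) (wgrad u1 x - wgrad u2 x).
  by rewrite -dotrVNl -dotrVDl /H dotrVZr.
have Z := ae_eq0_of_Rintegral (integrableB mO i1 i2) _ le0.
apply: (strong_grad_eq0 oO bO p1 i0 sv).
have : {ae leb, forall x, Omega x ->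
  dotrV (pflux p (wgrad u1 x)) (H x) - dotrV (pflux p (wgrad u2 x)) (H x) = 0}.
  by apply: Z => x _; rewrite Eq mulr_ge0// pflux_monotone.
apply: filterS => x + Ox => /(_ Ox)/eqP; rewrite Eq mulf_eq0 /H.
move=> /orP[/eqP ->|/eqP/(pflux_strict p1) ->]; first by rewrite scale0r.
by rewrite subrr scaler0.
Qed.

(** Tested with [rint (u1 - u2)], which vanishes only where [u1 <= u2] and has
gradient [rsat (u1 - u2)] times that of [u1 - u2]. *)
Lemma comparison_principle u1 u2 : W01p u1 -> W01p u2 ->
  (forall eta, W01p eta -> (forall x, 0 <= eta x) -> p_form u1 eta <= p_form u2 eta) ->
  le_ae Omega u1 u2.
Proof.
move=> W1 W2 H.
have sr := strong_grad_rint oO bO p1 (strong_gradB W1 W2).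
have [Wr _] := strong_grad_W01p oO bO p1 sr.
have r0 x : 0 <= (rint \o (fun x => u1 x - u2 x)) x by exact: rint_ge0.
have := monotone_test_eq0 W1 W2 _ sr (H _ Wr r0).
move=> /(_ (fun x => rsat_ge0 _)); apply: filterS => x + Ox => /(_ Ox) /= E.
by rewrite leNgt; apply/negP; rewrite -subr_gt0 => /rint_gt0; rewrite E ltxx.
Qed.

Lemma p_form_inj u1 u2 : W01p u1 -> W01p u2 ->
  p_form u1 (fun x => u1 x - u2 x) <= p_form u2 (fun x => u1 x - u2 x) ->
  eq_ae Omega u1 u2.
Proof.
move=> W1 W2 H.
have s1 : strong_grad (fun x => u1 x - u2 x)
    (fun x => (1 : R) *: (wgrad u1 x - wgrad u2 x)).
  by have := strong_gradB W1 W2; congr strong_grad; apply/funext => x; rewrite scale1r.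
have := monotone_test_eq0 W1 W2 (fun=> ler01) s1 H.
by apply: filterS => x + Ox => /(_ Ox)/eqP; rewrite subr_eq0 => /eqP.
Qed.

Lemma W01p0 : W01p (fun=> 0).
Proof. by have [] := strong_grad_W01p oO bO p1 (strong_grad0 oO bO p1). Qed.

Lemma wgrad0 : {ae leb, forall x, Omega x -> wgrad (fun=> 0) x = 0}.
Proof. by have [] := strong_grad_W01p oO bO p1 (strong_grad0 oO bO p1). Qed.

Lemma p_form0 v : W01p v -> p_form (fun=> 0) v = 0.
Proof.
move=> Wv.
have ip := integrable_pflux (Lp_wgrad W01p0) (Lp_wgrad Wv).
rewrite /p_form /Rintegral (@ae_eq_integral _ _ _ leb Omega (cst 0%E)).
- by rewrite integral_cst ?mul0e.
- exact: mO.
- exact: measurable_int ip.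
- exact: measurable_cst.
- apply: filterS wgrad0 => x + Ox => /(_ Ox) /= ->.
  by rewrite /pflux scaler0 /dotrV big1// => i _; rewrite mxE mul0r.
Qed.

Lemma Rintegral_ae_ge0 (g : 'rV[R]_N -> R) : measurable_fun Omega g ->
  {ae leb, forall x, Omega x -> 0 <= g x} -> 0 <= \int[leb]_(x in Omega) g x.
Proof.
move=> mg g0; have mg' : measurable_fun Omega (EFin \o g) by exact/measurable_EFinP.
rewrite /Rintegral (@ae_eq_integral _ _ _ leb Omega (abse \o (EFin \o g))).
- by apply: fine_ge0; apply: integral_ge0 => x _; exact: abse_ge0.
- exact: mO.
- exact: mg'.
- exact: measurableT_comp.
- by apply: filterS g0 => x + Ox => /(_ Ox) gx /=; rewrite ger0_norm.
Qed.

Section obstacle.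
Variables (f Gf : 'rV[R]_N -> R).
Hypothesis mf : measurable_fun Omega f.
Hypothesis f0 : le_ae Omega (fun=> 0) f.
Hypothesis hG : dirichlet_solution Omega p f Gf.

Let WG : W01p Gf. Proof. by case: hG. Qed.

Let load_ge0 eta : W01p eta -> (forall x, 0 <= eta x) ->
  0 <= \int[leb]_(x in Omega) (f x * eta x).
Proof.
move=> We e0; apply: Rintegral_ae_ge0.
  by apply: measurable_funM => //; exact: (W01p_Lp We).1.
by apply: filterS f0 => x + Ox => /(_ Ox) fx; rewrite mulr_ge0.
Qed.

(** The weak maximum principle: 0 solves the equation with a smaller load. *)
Lemma dirichlet_ge0 : le_ae Omega (fun=> 0) Gf.
Proof.
apply: comparison_principle => [||eta We e0]; [exact: W01p0|exact: WG|].
by rewrite p_form0// (hG.2 _ We) load_ge0.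
Qed.

(** Raising [u] keeps it above the obstacle, so [u] is a supersolution of the
equation solved by [Gf]. *)
Lemma dirichlet_le_obstacle psi u : obstacle_solution Omega p f psi u ->
  le_ae Omega Gf u.
Proof.
move=> [[Wu pu] VI]; apply: comparison_principle => [||eta We e0]; [exact: WG|exact: Wu|].
rewrite (hG.2 _ We).
have := VI (fun x => u x + eta x) _.
have -> : (fun x => u x + eta x - u x) = eta.
  by apply/funext => x; rewrite addrAC subrr add0r.
rewrite (_ : (\int[leb]_(x in Omega) (f x * (u x + eta x - u x))) =
    \int[leb]_(x in Omega) (f x * eta x)); last first.
  by apply: eq_Rintegral => x _; rewrite [_ + _ - _]addrAC subrr add0r.
apply; split; first exact: W01pD.
by apply: filterS pu => x + Ox => /(_ Ox) pux; rewrite (le_trans pux)// lerDl.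
Qed.

(** By [dirichlet_ge0], [Gf] competes in the variational inequality for [u], while
[Gf - u] is a test function for the equation of [Gf]; together these leave no room
between the two by [p_form_inj]. *)
Lemma obstacle0_dirichlet psi u : eq_ae Omega psi (fun=> 0) ->
  obstacle_solution Omega p f psi u -> eq_ae Omega u Gf.
Proof.
move=> psi0 [[Wu pu] VI].
have /VI H : obstacle_set Omega p psi Gf.
  split; first exact: WG.
  apply: filterS2 psi0 dirichlet_ge0 => x + + Ox.
  by move=> /(_ Ox) -> /(_ Ox).
have [WB _] := strong_grad_W01p oO bO p1 (strong_gradB WG Wu).
have := hG.2 _ WB => HG; rewrite -HG in H.
have := p_form_inj WG Wu H.
by apply: filterS => x + Ox => /(_ Ox) ->.
Qed.

End obstacle.

End p_laplacian.

(** * Minimization of the cost *)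

Section cost_functional.
Context {R : realType} {N : nat}.
Variable Omega : set 'rV[R]_N.
Hypothesis oO : open Omega.
Hypothesis bO : bounded_set Omega.
Variable p : R.
Hypothesis p1 : 1 < p.
Local Notation leb := (lebesgue_rV N : {measure set 'rV[R]_N -> \bar R}).
Local Notation Lp := (Lp Omega p).
Local Notation W01p := (W01p Omega p).
Local Notation wgrad := (wgrad Omega p).
Variables (T : ('rV[R]_N -> R) -> 'rV[R]_N -> R) (z : 'rV[R]_N -> R).
Hypothesis Lz : Lp z.

Let mO : measurable Omega. Proof. exact: open_measurable_rV. Qed.

Let p0 : 0 < p. Proof. by rewrite (lt_trans _ p1). Qed.

Definition gap v : \bar R := (\int[leb]_(x in Omega) (`|v x - z x| `^ p)%:E)%E.

Definition grad_energy psi : \bar R := (\int[leb]_(x in Omega) (enorm (wgrad psi x) `^ p)%:E)%E.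

Let Lp_gap v : Lp v -> Lp (fun x => v x - z x).
Proof. by move=> Lv; have := LpD oO p1 Lv (LpN oO p1 Lz). Qed.

Let gap_fin v : Lp v -> gap v \is a fin_num.
Proof. by move=> /Lp_gap[_ iv]; exact: integrable_fin_num. Qed.

Let grad_int psi : W01p psi ->
  leb.-integrable Omega (EFin \o (fun x => enorm (wgrad psi x) `^ p)).
Proof.
move=> Wp; have := (Lp_enorm oO bO p1 (Lp_wgrad oO p1 Wp)).2.
by congr integrable; apply/funext => x /=; rewrite ger0_norm// enorm_ge0.
Qed.

Let grad_fin psi : W01p psi -> grad_energy psi \is a fin_num.
Proof. by move=> /grad_int; exact: integrable_fin_num. Qed.

Let costE psi : W01p psi -> Lp (T psi) ->
  cost Omega p T z psi = (p^-1 * (fine (gap (T psi)) + fine (grad_energy psi)))%:E.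
Proof.
move=> Wp LT; rewrite EFinM EFinD /cost; congr (_ * _)%E.
transitivity (gap (T psi) + grad_energy psi)%E; last first.
  by congr (_ + _)%E; rewrite fineK ?gap_fin ?grad_fin.
rewrite /gap /grad_energy -ge0_integralD.
- by [].
- exact: mO.
- by move=> x _; rewrite lee_fin powR_ge0.
- exact: measurable_int (Lp_gap LT).2.
- by move=> x _; rewrite lee_fin powR_ge0.
- exact: measurable_int (grad_int Wp).
Qed.

Let gap_le v v' : Lp v -> Lp v' ->
  {ae leb, forall x, Omega x -> z x <= v x <= v' x} -> fine (gap v) <= fine (gap v').
Proof.
move=> Lv Lv' vv'; apply: fine_le; [exact: gap_fin|exact: gap_fin|].
apply: ae_ge0_le_integral.
- exact: mO.
- by move=> x _; rewrite lee_fin powR_ge0.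
- exact: measurable_int (Lp_gap Lv).2.
- by move=> x _; rewrite lee_fin powR_ge0.
- exact: measurable_int (Lp_gap Lv').2.
- apply: filterS vv' => x + Ox => /(_ Ox)/andP[zv vv].
  rewrite lee_fin ge0_ler_powR ?nnegrE ?(ltW p0)//.
  by rewrite !ger0_norm ?subr_ge0 ?(le_trans zv)// lerD2r.
Qed.

Let grad0 : fine (grad_energy (fun=> 0)) = 0.
Proof.
rewrite /grad_energy (@ae_eq_integral _ _ _ leb Omega (cst 0%E)).
- by rewrite integral_cst ?mul0e.
- exact: mO.
- exact: measurable_int (grad_int (W01p0 oO bO p1)).
- exact: measurable_cst.
- apply: filterS (wgrad0 oO bO p1) => x + Ox => /(_ Ox) /= ->.
  by rewrite enorm0 powR0// gt_eqF.
Qed.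

Let grad_ge0 psi : 0 <= fine (grad_energy psi).
Proof. by apply: fine_ge0; apply: integral_ge0 => x _; rewrite lee_fin powR_ge0. Qed.

Let grad_le0 psi (i0 : 'I_N) : W01p psi -> fine (grad_energy psi) <= 0 ->
  eq_ae Omega psi (fun=> 0).
Proof.
move=> Wp le0.
have := ae_eq0_of_Rintegral oO (grad_int Wp) (fun x _ => powR_ge0 _ _) le0.
move=> g0; apply: (strong_grad_eq0 oO bO p1 i0 (W01p_strong_grad oO p1 Wp)).
apply: filterS g0 => x + Ox => /(_ Ox) E; apply: enorm_eq0.
exact: powR_eq0_eq0 E.
Qed.

(** As [z <= Gf <= T psi], the null obstacle is the best one for the distance to
[z]; it is also the only one for which the gradient term vanishes. *)
Lemma cost_minimum (i0 : 'I_N) Gf : W01p Gf -> le_ae Omega z Gf ->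
  (forall psi, W01p psi -> W01p (T psi) /\ le_ae Omega Gf (T psi)) ->
  eq_ae Omega (T (fun=> 0)) Gf ->
  cost Omega p T z (fun=> 0) =
    ereal_inf [set cost Omega p T z psi | psi in [set v | W01p v]] /\
  forall psi, W01p psi ->
    cost Omega p T z psi = cost Omega p T z (fun=> 0) -> eq_ae Omega psi (fun=> 0).
Proof.
move=> WG zG TG T0; have W0 := W01p0 oO bO p1.
have LT psi : W01p psi -> Lp (T psi) by move=> /TG[W _]; exact: (W01p_Lp oO p1 W).
have gapT psi : W01p psi -> fine (gap (T (fun=> 0))) <= fine (gap (T psi)).
  move=> Wp; apply: gap_le; [exact: LT|exact: LT|].
  have [_ GT] := TG _ Wp.
  apply: filterS3 zG GT T0 => x + + + Ox => /(_ Ox) h1 /(_ Ox) h2 /(_ Ox) ->.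
  by rewrite h1 h2.
have pV : 0 < p^-1 by rewrite invr_gt0.
have le_sum (a b c d : R) : a <= c -> b = 0 -> 0 <= d -> a + b <= c + d.
  by move=> ac -> d0; exact: lerD.
have eq_sum (a b c d : R) : a <= c -> b = 0 ->
      (p^-1 * (c + d))%:E = (p^-1 * (a + b))%:E -> d <= 0.
  move=> ac b0 [E].
  by rewrite -(lerD2l c) (mulfI (lt0r_neq0 pV) E) b0 !addr0.
split.
  apply/eqP; rewrite eq_le; apply/andP; split.
    apply: le_ereal_inf_tmp => _ [psi Wp <-].
    rewrite (costE W0 (LT _ W0)) (costE Wp (LT _ Wp)) lee_fin (ler_pM2l pV).
    exact: le_sum (gapT _ Wp) grad0 (grad_ge0 psi).
  by apply: ereal_inf_lbound; exists (fun=> 0).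
move=> psi Wp cpsi.
have E := etrans (esym (costE Wp (LT _ Wp))) (etrans cpsi (costE W0 (LT _ W0))).
apply: (grad_le0 i0 Wp).
exact: eq_sum (gapT _ Wp) grad0 E.
Qed.

End cost_functional.

Theorem theorem3 (R : realType) (N : nat) (hN : (2 <= N)%N)
    (Omega : set 'rV[R]_N) (hOmega : bounded_domain Omega)
    (hbd : piecewise_C1_boundary Omega)
    (p : R) (hp : 1 < p)
    (f : 'rV[R]_N -> R) (hf : Lp_on Omega (hoelder_conjugate p%:E) f)
    (hf0 : le_ae Omega (fun=> 0) f)
    (T : ('rV[R]_N -> R) -> 'rV[R]_N -> R)
    (hT : obstacle_operator Omega p f T)
    (Gf : 'rV[R]_N -> R) (hG : dirichlet_solution Omega p f Gf)
    (z : 'rV[R]_N -> R) (hz : Lp_on Omega p%:E z) (hzG : le_ae Omega z Gf) :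
  optimal_pair Omega p T z (fun=> 0) Gf /\
  (forall psi u : 'rV[R]_N -> R, optimal_pair Omega p T z psi u ->
     eq_ae Omega psi (fun=> 0) /\ eq_ae Omega u Gf).
Proof.
have [oO _ _ bO] := hOmega.
have mf := measurable_of_Lp_on oO hf.
(* Any coordinate direction would do in [strong_grad_eq0]. *)
pose i0 : 'I_N := Ordinal (ltnW hN).
have W0 := W01p0 oO bO hp.
have TG psi : W01p Omega p psi -> W01p Omega p (T psi) /\ le_ae Omega Gf (T psi).
  move=> /hT S; split; first by have [[]] := S.
  exact: (dirichlet_le_obstacle oO bO hp i0 hG S).
have T_G psi : W01p Omega p psi -> eq_ae Omega psi (fun=> 0) -> eq_ae Omega (T psi) Gf.
  move=> /hT S psi0.
  exact: (obstacle0_dirichlet oO bO hp i0 mf hf0 hG psi0 S).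
have T0 : eq_ae Omega (T (fun=> 0)) Gf by apply: (T_G _ W0); exact: aeW.
have Lz := proj1 (Lp_onP oO hp z) hz.
have [inf0 uniq] := cost_minimum oO bO hp Lz i0 hG.1 hzG TG T0.
split.
  split; [exact: W0| |exact: inf0].
  by apply: filterS T0 => x + Ox => /(_ Ox).
move=> psi u [Wpsi uT cpsi].
have psi0 : eq_ae Omega psi (fun=> 0) by apply: (uniq _ Wpsi); rewrite cpsi inf0.
split; first exact: psi0.
by apply: filterS2 uT (T_G _ Wpsi psi0) => x + + Ox => /(_ Ox) -> /(_ Ox).
Qed.
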